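(* Let $n,d\ge 1$ be integers. The abacus monoid $\mathring{R}'_{d,n}$ is presented by the generators $\mathsf{s}_1,\dots,\mathsf{s}_{n-1}$, $r_1,\dots,r_n$, $\mathsf{o}_1,\dots,\mathsf{o}_n$ subject to the following relations (whenever the indices make sense): $$\mathsf{s}_i^2=1;\quad \mathsf{s}_i\mathsf{s}_j=\mathsf{s}_j\mathsf{s}_i\ (|i-j|>1);\quad \mathsf{s}_i\mathsf{s}_j\mathsf{s}_i=\mathsf{s}_j\mathsf{s}_i\mathsf{s}_j\ (|i-j|=1);$$ $$r_i^2=r_i;\quad r_ir_j=r_jr_i;\quad r_j\mathsf{s}_i=\mathsf{s}_ir_j\ (j\ne i,i+1);\quad r_i\mathsf{s}_i=\mathsf{s}_ir_{i+1};\quad r_{i+1}\mathsf{s}_i=\mathsf{s}_ir_i;\quad r_i\mathsf{s}_ir_i=r_ir_{i+1};$$ $$\mathsf{o}_i^d=1;\quad \mathsf{o}_i\mathsf{o}_j=\mathsf{o}_j\mathsf{o}_i;\quad \mathsf{o}_j\mathsf{s}_i=\mathsf{s}_i\mathsf{o}_{s_i(j)};$$ $$r_i\mathsf{o}_j=\mathsf{o}_jr_i\ (i\ne j);\quad r_i\mathsf{o}_i^kr_i=r_i\ (\text{all } i,k),$$ where $s_i(j)$ is the image of $j$ under the transposition $(i,i+1)$. Hence the framed rook monoid $R'_{d,n}$ is isomorphic to $\mathring{R}'_{d,n}$, and its cardinality is $\sum_{k=0}^n\binom{n}{k}^2k!\,d^{2n-k}$.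
   Context: Abacus monoid $\mathring{R}'_{d,n}$: a rook diagram has $n$ points $1,\dots,n$ on a top line and $n$ points $1,\dots,n$ on a bottom line, together with $k\le n$ lines, each joining a top point to a bottom point, such that each point lies on at most one line. Each of the $2(n-k)$ points not lying on a line is the endpoint of a ''broken arc'', whose other end is free. The elements of $\mathring{R}'_{d,n}$ are the rook diagrams in which each line and each broken arc carries a number of beads in $\{0,\dots,d-1\}$ (free ends block the beads). The product $ab$ is obtained by placing $a$ above $b$ and concatenating; when arcs (lines or broken arcs) are joined, their numbers of beads are added modulo $d$ (two lines joined give a line; a line joined with a broken arc gives a broken arc); arcs with two free ends, with or without beads, are discarded. The elements: $\mathsf{s}_i$ is the bead-free diagram of the transposition $(i,i+1)$ (lines top $i$ – bottom $i+1$, top $i+1$ – bottom $i$, and top $j$ – bottom $j$ otherwise); $r_i$ is the bead-free diagram with lines top $j$ – bottom $j$ for $j\neq i$ and broken arcs at top $i$ and bottom $i$; $\mathsf{o}_i$ is the identity diagram with one bead on the $i$-th line (beads counted modulo $d$). Framed rook monoid $R'_{d,n}$: the monoid presented by generators $s_1,\dots,s_{n-1},p_1,\dots,p_n,z_1,\dots,z_n$ and relations: $s_i^2=1$, $s_is_j=s_js_i$ for $|i-j|>1$, $s_is_js_i=s_js_is_j$ for $|i-j|=1$; $p_i^2=p_i$, $p_ip_j=p_jp_i$; $p_is_j=s_jp_i$ for $i<j$; $p_is_j=s_jp_i=p_i$ for $1\le j<i\le n$; $p_is_ip_i=p_{i+1}$ for $1\le i\le n-1$; $z_i^d=1$, $z_iz_j=z_jz_i$;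 $z_js_i=s_iz_{s_i(j)}$; $p_iz_j=z_jp_i$ for $1\le i<j\le n$; and $p_iz_1^{m_1}z_2^{m_2}\cdots z_i^{m_i}p_j=p_jz_1^{m_1}z_2^{m_2}\cdots z_i^{m_i}p_i=p_j$ for $1\le i\le j\le n$ and all exponents $m_1,\dots,m_i$. *)

(* Defs.v *)
From HB Require Import structures.
From mathcomp Require Import all_boot perm all_algebra.
From mathcomp Require Import all_classical.

Set Implicit Arguments.
Unset Strict Implicit.
Unset Printing Implicit Defensive.

Import GRing.Theory.

Local Open Scope quotient_scope.

(* Words over X are elements of seq X, with concatenation as product. *)
Section Presentation.
Variables (X : choiceType) (R : seq X -> seq X -> Prop).

Inductive congr_closure : seq X -> seq X -> Prop :=
| cc_rel u v : R u v -> congr_closure u v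
| cc_refl u : congr_closure u u
| cc_sym u v : congr_closure u v -> congr_closure v u
| cc_trans u v w :
    congr_closure u v -> congr_closure v w -> congr_closure u w
| cc_cat u u' v v' :
    congr_closure u u' -> congr_closure v v' ->
    congr_closure (u ++ v) (u' ++ v').

Definition congrb : rel (seq X) := fun u v => `[< congr_closure u v >].

Lemma congrb_refl : reflexive congrb.
Proof. by move=> u; apply/asboolP; exact: cc_refl. Qed.

Lemma congrb_sym : symmetric congrb.
Proof. by move=> u v; apply/asboolP/asboolP; exact: cc_sym. Qed.

Lemma congrb_trans : transitive congrb.
Proof.
by move=> v u w /asboolP uv /asboolP vw; apply/asboolP; exact: cc_trans uv vw.
Qed.

Canonical congrb_equiv := EquivRel congrb congrb_refl congrb_sym congrb_trans.

Definition presented : Type := {eq_quot congrb_equiv}.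

HB.instance Definition _ := Choice.on presented.
HB.instance Definition _ := Quotient.on presented.
HB.instance Definition _ := EqQuotient.on presented.

Definition pclass (u : seq X) : presented := \pi_presented%qT u.
Definition pone : presented := pclass [::].
Definition pmul (a b : presented) : presented :=
  pclass (repr a ++ repr b).

Lemma pclassP u v : pclass u = pclass v <-> congr_closure u v.
Proof. by split=> [/eqmodP/asboolP|uv] //; apply/eqmodP/asboolP. Qed.

Lemma pclass_repr a : pclass (repr a) = a.
Proof. exact: reprK. Qed.

Lemma pclass_cat u v : pmul (pclass u) (pclass v) = pclass (u ++ v).
Proof. by apply/pclassP/cc_cat; apply/pclassP; rewrite pclass_repr. Qed.

Lemma pmulA : associative pmul.
Proof.
move=> a b c; rewrite -[a]pclass_repr -[b]pclass_repr -[c]pclass_repr.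
by rewrite !pclass_cat catA.
Qed.

Lemma pmul1 : left_id pone pmul.
Proof. by move=> a; rewrite -[a]pclass_repr pclass_cat. Qed.

Lemma pmulr1 : right_id pone pmul.
Proof. by move=> a; rewrite -[a]pclass_repr pclass_cat cats0. Qed.

HB.instance Definition _ := isMonoid.Build presented pmulA pmul1 pmulr1.

Definition pgen (x : X) : presented := pclass [:: x].

End Presentation.

(* M is presented by the generators e x (x : X) subject to the relations R. *)
Definition is_presentation (X : choiceType) (R : seq X -> seq X -> Prop)
    (M : monoidType) (e : X -> M) : Prop :=
  exists f : presented R -> M,
    [/\ f 1%g = 1%g, {morph f : a b / (a * b)%g}, bijective f &
        forall x, f (pgen R x) = e x].

Definition monoid_isomorphic (M N : monoidType) : Prop :=
  exists f : M -> N,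
    [/\ f 1%g = 1%g, {morph f : a b / (a * b)%g} & bijective f].

(* Indices are 0-based: i : 'I_n stands for the index i + 1. An index        *)
(* i : 'I_n.-1 of a transposition is also an index lo i : 'I_n, and hi i is  *)
(* the next one, so that the transposition exchanges lo i and hi i.          *)
Section Indices.
Variables (n : nat) (i : 'I_n.-1).

Lemma lo_subproof : i < n.
Proof. exact: leq_trans (ltn_ord i) (leq_pred n). Qed.

Lemma hi_subproof : i.+1 < n.
Proof. by case: n i => [|m] [k]. Qed.

Definition lo : 'I_n := Ordinal lo_subproof.
Definition hi : 'I_n := Ordinal hi_subproof.

End Indices.

(* For d >= 1, 'I_d.-1.+1 is 'I_d with addition modulo d. *)
Notation beads d := 'I_d.-1.+1.

Section Abacus.
Variables n d : nat.

(* dn i = Some j (equivalently up j = Some i) when a line joins top point i  *)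
(* to bottom point j; dn i = None (resp. up j = None) when top point i       *)
(* (resp. bottom point j) is the endpoint of a broken arc. The number of     *)
(* beads on an arc is recorded at each of its non-free endpoints: topb at a  *)
(* top point, botb at a bottom point; both values agree on a line.           *)
Definition abacus_data : Type :=
  {ffun 'I_n -> option 'I_n} * {ffun 'I_n -> option 'I_n} *
  {ffun 'I_n -> beads d} * {ffun 'I_n -> beads d}.

Definition abacus_axiom (x : abacus_data) : bool :=
  let: (dn, up, topb, botb) := x in
  [forall i, forall j, ((dn i == Some j) == (up j == Some i)) &&
                       ((dn i == Some j) ==> (topb i == botb j))].

Record abacus : Type := Abacus {
  abacus_val :> abacus_data;
  abacus_valP : abacus_axiom abacus_val }.

HB.instance Definition _ := [isSub for abacus_val].
HB.instance Definition _ := [Finite of abacus by <:].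

Definition dn (a : abacus) : {ffun 'I_n -> option 'I_n} := (val a).1.1.1.
Definition up (a : abacus) : {ffun 'I_n -> option 'I_n} := (val a).1.1.2.
Definition topb (a : abacus) : {ffun 'I_n -> beads d} := (val a).1.2.
Definition botb (a : abacus) : {ffun 'I_n -> beads d} := (val a).2.

Lemma abacus_axiomP (dn up : {ffun 'I_n -> option 'I_n})
    (topb botb : {ffun 'I_n -> beads d}) :
  (forall i j, dn i = Some j <-> up j = Some i) ->
  (forall i j, dn i = Some j -> topb i = botb j) ->
  abacus_axiom (dn, up, topb, botb).
Proof.
move=> du tb; apply/forallP=> i; apply/forallP=> j; apply/andP; split.
  by apply/eqP; apply/eqP/eqP=> /du.
by apply/implyP=> /eqP/tb->.
Qed.

Lemma dn_up (a : abacus) i j : dn a i = Some j <-> up a j = Some i.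
Proof.
case: a => -[[[f g] t] b] /= ax; rewrite /dn /up /=.
move/forallP/(_ i)/forallP/(_ j)/andP: ax => [/eqP fg _].
by split=> /eqP e; apply/eqP; rewrite ?fg // -fg.
Qed.

Lemma topb_botb (a : abacus) i j : dn a i = Some j -> topb a i = botb a j.
Proof.
case: a => -[[[f g] t] b] /= ax; rewrite /dn /topb /botb /= => /eqP fij.
by move/forallP/(_ i)/forallP/(_ j)/andP: ax => [_ /implyP/(_ fij)/eqP].
Qed.

Lemma abacus_eq (a b : abacus) :
  dn a =1 dn b -> up a =1 up b -> topb a =1 topb b -> botb a =1 botb b ->
  a = b.
Proof.
case: a b => [[[[f g] t] b] p] [[[[f' g'] t'] b'] p'].
rewrite /dn /up /topb /botb /= => /ffunP ef /ffunP eg /ffunP et /ffunP eb.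
by apply: val_inj; rewrite /= ef eg et eb.
Qed.

Definition abacus_one_data : abacus_data :=
  ([ffun i => Some i], [ffun i => Some i], [ffun=> 0%R], [ffun=> 0%R]).

Lemma abacus_one_subproof : abacus_axiom abacus_one_data.
Proof.
by apply: abacus_axiomP=> i j; rewrite !ffunE //; split=> -[->].
Qed.

Definition abacus_one : abacus := Abacus abacus_one_subproof.

(* a above b. *)
Definition abacus_mul_data (a b : abacus) : abacus_data :=
  ([ffun i => obind (dn b) (dn a i)],
   [ffun k => obind (up a) (up b k)],
   [ffun i => (topb a i + if dn a i is Some j then topb b j else 0)%R],
   [ffun k => ((if up b k is Some j then botb a j else 0) + botb b k)%R]).

Lemma abacus_mul_subproof a b : abacus_axiom (abacus_mul_data a b).
Proof.
apply: abacus_axiomP=> i k; rewrite !ffunE.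
  split.
    case E: (dn a i) => [j|] //= /dn_up Ek.
    by rewrite Ek /=; apply/dn_up.
  case E: (up b k) => [j|] //= /dn_up Ei.
  by rewrite Ei /=; apply/dn_up.
case E: (dn a i) => [j|] //= Ek; have /dn_up -> := Ek.
by rewrite (topb_botb E) (topb_botb Ek).
Qed.

Definition abacus_mul (a b : abacus) : abacus :=
  Abacus (abacus_mul_subproof a b).

Lemma dn_mul a b i : dn (abacus_mul a b) i = obind (dn b) (dn a i).
Proof. by rewrite /dn /= ffunE. Qed.
Lemma up_mul a b k : up (abacus_mul a b) k = obind (up a) (up b k).
Proof. by rewrite /up /= ffunE. Qed.
Lemma topb_mul a b i : topb (abacus_mul a b) i =
  (topb a i + if dn a i is Some j then topb b j else 0)%R.
Proof. by rewrite /topb /= ffunE. Qed.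
Lemma botb_mul a b k : botb (abacus_mul a b) k =
  ((if up b k is Some j then botb a j else 0) + botb b k)%R.
Proof. by rewrite /botb /= ffunE. Qed.

Lemma abacus_mulA : associative abacus_mul.
Proof.
move=> a b c; apply: abacus_eq => i.
- by rewrite !dn_mul; case: (dn a i) => //= j; rewrite dn_mul.
- by rewrite !up_mul; case: (up c i) => //= j; rewrite up_mul.
- rewrite !topb_mul dn_mul -addrA; congr (_ + _)%R.
  by case: (dn a i) => [j|] /=; rewrite ?topb_mul ?addr0.
rewrite !botb_mul up_mul addrA; congr (_ + _)%R.
by case: (up c i) => [j|] /=; rewrite ?botb_mul ?addr0.
Qed.

Lemma dn_one i : dn abacus_one i = Some i.
Proof. by rewrite /dn /= ffunE. Qed.
Lemma up_one i : up abacus_one i = Some i.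
Proof. by rewrite /up /= ffunE. Qed.
Lemma topb_one i : topb abacus_one i = 0%R.
Proof. by rewrite /topb /= ffunE. Qed.
Lemma botb_one i : botb abacus_one i = 0%R.
Proof. by rewrite /botb /= ffunE. Qed.

Lemma abacus_mul1 : left_id abacus_one abacus_mul.
Proof.
move=> a; apply: abacus_eq => i.
- by rewrite dn_mul dn_one.
- by rewrite up_mul; case: (up a i) => //= j; rewrite up_one.
- by rewrite topb_mul topb_one dn_one add0r.
by rewrite botb_mul; case: (up a i) => [j|]; rewrite ?botb_one add0r.
Qed.

Lemma abacus_mulr1 : right_id abacus_one abacus_mul.
Proof.
move=> a; apply: abacus_eq => i.
- by rewrite dn_mul; case: (dn a i) => //= j; rewrite dn_one.
- by rewrite up_mul up_one.
- by rewrite topb_mul; case: (dn a i) => [j|]; rewrite ?topb_one addr0.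
by rewrite botb_mul botb_one up_one addr0.
Qed.

HB.instance Definition _ :=
  isMonoid.Build abacus abacus_mulA abacus_mul1 abacus_mulr1.

Definition abacus_s_data (i : 'I_n.-1) : abacus_data :=
  ([ffun j => Some (tperm (lo i) (hi i) j)],
   [ffun j => Some (tperm (lo i) (hi i) j)], [ffun=> 0%R], [ffun=> 0%R]).

Lemma abacus_s_subproof i : abacus_axiom (abacus_s_data i).
Proof.
by apply: abacus_axiomP=> j k; rewrite !ffunE //; split=> -[<-]; rewrite tpermK.
Qed.

Definition abacus_s i : abacus := Abacus (abacus_s_subproof i).

Definition abacus_r_data (i : 'I_n) : abacus_data :=
  ([ffun j => if j == i then None else Some j],
   [ffun j => if j == i then None else Some j], [ffun=> 0%R], [ffun=> 0%R]).

Lemma abacus_r_subproof i : abacus_axiom (abacus_r_data i).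
Proof.
apply: abacus_axiomP=> j k; rewrite !ffunE //.
by split; case: ifP => // E [<-]; rewrite E.
Qed.

Definition abacus_r i : abacus := Abacus (abacus_r_subproof i).

(* inZp 1 is one bead, counted modulo d (hence no bead when d = 1). *)
Definition abacus_o_data (i : 'I_n) : abacus_data :=
  ([ffun j => Some j], [ffun j => Some j],
   [ffun j => if j == i then inZp 1 else 0%R],
   [ffun j => if j == i then inZp 1 else 0%R]).

Lemma abacus_o_subproof i : abacus_axiom (abacus_o_data i).
Proof.
by apply: abacus_axiomP=> j k; rewrite !ffunE; [split=> -[->]|case=> ->].
Qed.

Definition abacus_o i : abacus := Abacus (abacus_o_subproof i).

End Abacus.

(* One alphabet serves both presentations: gs i is s_i, gp i is r_i or p_i,  *)
(* gz i is o_i or z_i.                                                       *)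
Inductive gen (n : nat) : Type :=
| gs of 'I_n.-1
| gp of 'I_n
| gz of 'I_n.
Arguments gs {n}. Arguments gp {n}. Arguments gz {n}.

Section GenChoice.
Variable n : nat.

Definition gen_code (x : gen n) : 'I_n.-1 + 'I_n + 'I_n :=
  match x with gs i => inl (inl i) | gp i => inl (inr i) | gz i => inr i end.

Definition gen_decode (c : 'I_n.-1 + 'I_n + 'I_n) : gen n :=
  match c with inl (inl i) => gs i | inl (inr i) => gp i | inr i => gz i end.

Lemma gen_codeK : cancel gen_code gen_decode.
Proof. by case. Qed.

HB.instance Definition _ := Finite.copy (gen n) (can_type gen_codeK).

End GenChoice.

Definition abacus_gen (n d : nat) (x : gen n) : abacus n d :=
  match x with
  | gs i => abacus_s d i
  | gp i => abacus_r d i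
  | gz i => abacus_o d i
  end.

Inductive abacus_rel (n d : nat) : seq (gen n) -> seq (gen n) -> Prop :=
| ar_ss i : abacus_rel d [:: gs i; gs i] [::]
| ar_sC (i j : 'I_n.-1) : (i.+1 < j) || (j.+1 < i) ->
    abacus_rel d [:: gs i; gs j] [:: gs j; gs i]
| ar_sB (i j : 'I_n.-1) : (i.+1 == j) || (j.+1 == i) ->
    abacus_rel d [:: gs i; gs j; gs i] [:: gs j; gs i; gs j]
| ar_rr i : abacus_rel d [:: gp i; gp i] [:: gp i]
| ar_rC i j : abacus_rel d [:: gp i; gp j] [:: gp j; gp i]
| ar_rs (i : 'I_n.-1) (j : 'I_n) : j != lo i -> j != hi i ->
    abacus_rel d [:: gp j; gs i] [:: gs i; gp j]
| ar_rslo i : abacus_rel d [:: gp (lo i); gs i] [:: gs i; gp (hi i)]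
| ar_rshi i : abacus_rel d [:: gp (hi i); gs i] [:: gs i; gp (lo i)]
| ar_rsr i :
    abacus_rel d [:: gp (lo i); gs i; gp (lo i)] [:: gp (lo i); gp (hi i)]
| ar_od i : abacus_rel d (nseq d (gz i)) [::]
| ar_oC i j : abacus_rel d [:: gz i; gz j] [:: gz j; gz i]
| ar_os (i : 'I_n.-1) (j : 'I_n) :
    abacus_rel d [:: gz j; gs i] [:: gs i; gz (tperm (lo i) (hi i) j)]
| ar_ro (i j : 'I_n) : i != j ->
    abacus_rel d [:: gp i; gz j] [:: gz j; gp i]
| ar_ror (i : 'I_n) (k : nat) :
    abacus_rel d (gp i :: nseq k (gz i) ++ [:: gp i]) [:: gp i].

(* z_1^(m 1) ... z_i^(m i) *)
Definition zprod (n : nat) (i : 'I_n) (m : 'I_n -> nat) : seq (gen n) :=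
  flatten [seq nseq (m k) (gz k) | k : 'I_n <- enum 'I_n & k <= i].

Inductive framed_rel (n d : nat) : seq (gen n) -> seq (gen n) -> Prop :=
| fr_ss i : framed_rel d [:: gs i; gs i] [::]
| fr_sC (i j : 'I_n.-1) : (i.+1 < j) || (j.+1 < i) ->
    framed_rel d [:: gs i; gs j] [:: gs j; gs i]
| fr_sB (i j : 'I_n.-1) : (i.+1 == j) || (j.+1 == i) ->
    framed_rel d [:: gs i; gs j; gs i] [:: gs j; gs i; gs j]
| fr_pp i : framed_rel d [:: gp i; gp i] [:: gp i]
| fr_pC i j : framed_rel d [:: gp i; gp j] [:: gp j; gp i]
| fr_ps (i : 'I_n) (j : 'I_n.-1) : i < j ->
    framed_rel d [:: gp i; gs j] [:: gs j; gp i]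
| fr_ps_l (i : 'I_n) (j : 'I_n.-1) : j < i ->
    framed_rel d [:: gp i; gs j] [:: gp i]
| fr_ps_r (i : 'I_n) (j : 'I_n.-1) : j < i ->
    framed_rel d [:: gs j; gp i] [:: gp i]
| fr_psp i : framed_rel d [:: gp (lo i); gs i; gp (lo i)] [:: gp (hi i)]
| fr_zd i : framed_rel d (nseq d (gz i)) [::]
| fr_zC i j : framed_rel d [:: gz i; gz j] [:: gz j; gz i]
| fr_zs (i : 'I_n.-1) (j : 'I_n) :
    framed_rel d [:: gz j; gs i] [:: gs i; gz (tperm (lo i) (hi i) j)]
| fr_pz (i j : 'I_n) : i < j ->
    framed_rel d [:: gp i; gz j] [:: gz j; gp i]
| fr_pzp_l (i j : 'I_n) (m : 'I_n -> nat) : i <= j ->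
    framed_rel d (gp i :: zprod i m ++ [:: gp j]) [:: gp j]
| fr_pzp_r (i j : 'I_n) (m : 'I_n -> nat) : i <= j ->
    framed_rel d (gp j :: zprod i m ++ [:: gp i]) [:: gp j].

Definition framed_rook (n d : nat) : monoidType := presented (@framed_rel n d).

(* Main.v *)
(* Every abacus is a product of beads on the top points, cut strands, a
   permutation, and beads on the broken arcs at the bottom. The same product,
   formed in a monoid M whose elements satisfy the relations, defines a map from
   the abacus monoid to M. The permutation is determined only off the cut
   strands, but r_x r_y absorbs the transposition (x, y), so its choice does not
   matter. The map commutes with left multiplication by generators; hence, when
   M is the presented monoid, it inverts the evaluation of words. The Coxeter
   presentation of the symmetric group, needed to place permutations in M,
   follows from the confluence of sorting by descents. In the framed rook monoid
   the conjugates r_i of p_1 by permutations satisfy the abacus relations and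
   p_i = r_1 ... r_i, which gives the isomorphism. *)
Require Import Defs.
From mathcomp Require Import all_boot perm ssralg zmodp zify.
From mathcomp Require Import all_classical.

Set Implicit Arguments.
Unset Strict Implicit.
Unset Printing Implicit Defensive.

Import GRing.Theory.

Local Open Scope group_scope.

(** * The symmetric group *)

Section AdjacentTranspositions.
Variable n : nat.
Implicit Types (i j : 'I_n.-1) (w : 'S_n).

Definition adj i : 'S_n := tperm (lo i) (hi i).

Lemma lo_neq_hi i : lo i != hi i.
Proof. by rewrite -val_eqE /= neq_ltn ltnSn. Qed.

Lemma adjK i : adj i * adj i = 1.
Proof. exact: tperm2. Qed.

Lemma adjKw i w : adj i * (adj i * w) = w.
Proof. by rewrite mulgA adjK mul1g. Qed.

Lemma adj_lo i : adj i (lo i) = hi i. Proof. exact: tpermL. Qed.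
Lemma adj_hi i : adj i (hi i) = lo i. Proof. exact: tpermR. Qed.
Lemma adjD i x : x != lo i -> x != hi i -> adj i x = x.
Proof. by move=> xl xh; rewrite tpermD // eq_sym. Qed.

Lemma lo_hi i j : i.+1 = j -> lo j = hi i.
Proof. by move=> ij; apply: val_inj; rewrite /= ij. Qed.

Lemma adj_far i j : (i.+1 < j) || (j.+1 < i) -> adj i * adj j = adj j * adj i.
Proof.
move=> ij; apply/permP => x; rewrite !permM.
have [->|xli] := eqVneq x (lo i); last have [->|xhi] := eqVneq x (hi i).
- by rewrite adj_lo !(@adjD j) ?adj_lo // -val_eqE /=; lia.
- by rewrite adj_hi !(@adjD j) ?adj_hi // -val_eqE /=; lia.
rewrite (@adjD i x) //.
have [->|xlj] := eqVneq x (lo j); last have [->|xhj] := eqVneq x (hi j).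
- by rewrite adj_lo (@adjD i) // -val_eqE /=; lia.
- by rewrite adj_hi (@adjD i) // -val_eqE /=; lia.
by rewrite (@adjD j) // (@adjD i).
Qed.

(** Both sides are conjugates of one adjacent transposition by the other, and both equal the
    transposition of [lo i] and [hi j]. *)
Lemma adj_near i j : i.+1 = j -> adj i * adj j * adj i = adj j * adj i * adj j.
Proof.
move=> ij; have hl : lo j = hi i by apply: val_inj; rewrite /= ij.
have -> : adj i * adj j * adj i = tperm (lo i) (hi j).
  rewrite /adj -[X in X * _ * _]tpermV -mulgA -conjgE tpermJ.
  rewrite hl tpermR tpermD // -?hl ?lo_neq_hi //.
  by rewrite -val_eqE /=; lia.
have -> // : adj j * adj i * adj j = tperm (lo i) (hi j).
rewrite /adj -[X in X * _ * _]tpermV -mulgA -conjgE tpermJ -hl tpermL.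
by rewrite tpermD // -val_eqE /=; lia.
Qed.

Definition descent i w := w (hi i) < w (lo i).

(* A weight that decreases when a descent is sorted, replacing the number of
   inversions. *)
Definition energy w := (\sum_(x : 'I_n) x * (n - w x))%N.

Lemma energy_descent i w : descent i w -> energy (adj i * w) < energy w.
Proof.
rewrite /descent /energy => dw.
have D (F : 'I_n -> nat) :
    (\sum_x F x =
     F (lo i) + (F (hi i) + \sum_(x | (x != lo i) && (x != hi i)) F x))%N.
  by rewrite (bigD1 (lo i)) // (bigD1 (hi i)) //= eq_sym lo_neq_hi.
rewrite !D !permM adj_lo adj_hi.
rewrite (eq_bigr (fun x : 'I_n => (x * (n - w x))%N)) => [|x /andP[xl xh]];
  last first.
  by rewrite permM adjD.
(* Sorting exchanges the factors x = n - w (lo i) and y = n - w (hi i), so that the larger factor y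
   moves to the smaller position k. *)
have ineq k x y T : x < y -> (k * y + (k.+1 * x + T) < k * x + (k.+1 * y +
  T))%N.
  by lia.
by apply: ineq; exact: ltn_sub2l (ltn_ord _) dw.
Qed.

Lemma descent_adj i w : ~~ descent i w -> descent i (adj i * w).
Proof.
rewrite /descent !permM adj_lo adj_hi -leqNgt leq_eqVlt =>
  /orP[/eqP/val_inj|//].
by move/perm_inj/eqP; rewrite (negbTE (lo_neq_hi i)).
Qed.

(** Without descents the values increase, hence [x <= w x] everywhere; the values have the same sum
    as the arguments, which forces equality. *)
Lemma no_descent w : (forall i, ~~ descent i w) -> w = 1.
Proof.
move=> ndw; suff le_w (x : 'I_n) : x <= w x.
  have /leqif_sum H : forall x : 'I_n, true -> x <= w x ?= iff (x == w x).
    by move=> x _; split; rewrite ?le_w.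
  have E : \sum_(x < n) w x = \sum_(x < n) x.
    by rewrite [RHS](reindex_inj (@perm_inj _ w)).
  have := (H).2; rewrite E eqxx => /esym/forallP eqw.
  by apply/permP => x; rewrite perm1; have /eqP <- := eqw x.
case: x => k; elim: k => // k IH lkn.
have lk : k < n.-1 by lia.
have lt_kn : k < n by lia.
have := IH lt_kn; have := ndw (Ordinal lk); rewrite /descent -leqNgt /=.
have -> : lo (Ordinal lk) = Ordinal lt_kn by apply: val_inj.
have -> : hi (Ordinal lk) = Ordinal lkn by apply: val_inj.
rewrite leq_eqVlt => /orP[/eqP/val_inj/perm_inj/(congr1 val)/= /eqP|].
  by rewrite eqn_leq ltnn andbF.
by move=> lt1 lt2; apply: leq_ltn_trans lt2 lt1.
Qed.

(** Sorting descents ends at the identity, so the adjacent transpositions generate the symmetric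
    group. *)
Lemma perm_adj_ind (P : 'S_n -> Prop) :
  P 1 -> (forall i w, P w -> P (adj i * w)) -> forall w, P w.
Proof.
move=> P1 Padj w; have [k] := ubnP (energy w).
elim: k w => // k IH w lt_wk.
have [/existsP[i dw]|/existsPn/no_descent ->] // := boolP [exists i, descent i
  w].
rewrite -(adjKw i w); apply: Padj; apply: IH.
exact: leq_trans (energy_descent dw) _.
Qed.

End AdjacentTranspositions.

(** * The Coxeter presentation of the symmetric group *)

Section Coxeter.
Variables (n : nat) (M : monoidType) (s : 'I_n.-1 -> M).
Hypothesis ss : forall i, s i * s i = 1.
Hypothesis s_far : forall i j : 'I_n.-1,
  (i.+1 < j) || (j.+1 < i) -> s i * s j = s j * s i.
Hypothesis s_near : forall i j : 'I_n.-1,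
  i.+1 = j -> s i * s j * s i = s j * s i * s j.
Implicit Types (i j : 'I_n.-1) (w : 'S_n) (m : M).

(** A relation rather than a function, because the descent to be sorted is chosen freely at each
    stage; the element of [M] records the generators used. *)
Inductive sorted_word : 'S_n -> M -> Prop :=
| sorted_word1 : sorted_word 1 1
| sorted_word_descent i w m : descent i w -> sorted_word (adj i * w) m ->
    sorted_word w (s i * m).

Lemma sorted_word_total w : exists m, sorted_word w m.
Proof.
have [k] := ubnP (energy w); elim: k w => // k IH w lt_wk.
have [/existsP[i dw]|/existsPn/no_descent ->] := boolP [exists i, descent i w].
  have [|m wm] := IH (adj i * w); first exact: leq_trans (energy_descent dw) _.
  by exists (s i * m); apply: sorted_word_descent.
by exists 1; exact: sorted_word1.
Qed.

(* Two descents i and j of w can be completed to equal products because w is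
   then sorted through the longest element of the subgroup generated by the
   adjacent transpositions i and j. *)
Lemma sorted_word_fun w m m' : sorted_word w m -> sorted_word w m' -> m = m'.
Proof.
have [k] := ubnP (energy w); elim: k w m m' => // k IH w m m' lt_wk wm wm'.
have no1 i : ~~ descent i (1 : 'S_n) by rewrite /descent !perm1 -leqNgt /=.
case: wm lt_wk wm' => [|i {}w {}m di wm] lt_wk wm'.
  inversion wm' as [|j w' n' dj _ e1 e2]; first by [].
  by move: dj; rewrite (negbTE (no1 j)).
have [e|] := eqVneq w 1; first by move: di; rewrite e (negbTE (no1 i)).
case: wm' lt_wk di wm => [|j {}w {}m' dj wm'] lt_wk di wm;
  first by rewrite eqxx.
move=> _.
(* By induction every sorting of [adj i * w] has value [m], so its next descent can be chosen at
   will; likewise for [j] and [m']. *)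
have IHi l : sorted_word (adj i * w) l -> m = l.
  by move=> wl; apply: IH wm wl; apply: leq_trans (energy_descent di) _.
have IHj l : sorted_word (adj j * w) l -> m' = l.
  by move=> wl; apply: IH wm' wl; apply: leq_trans (energy_descent dj) _.
have [e|nij] := eqVneq i j.
  by rewrite -e in wm' *; rewrite (IHi _ wm').
clear IH wm wm' lt_wk; wlog ltij : i j m m' di dj IHi IHj nij / i < j.
  case: (ltngtP i j) => [lij W|lji W|/val_inj e _].
  - exact: W lij.
  - by apply/esym/(W j i) => //; rewrite eq_sym.
  by rewrite e eqxx in nij.
have [near|far] := eqVneq i.+1 j; last first.
  have {}far : (i.+1 < j) by rewrite ltn_neqAle far.
  (* Distant descents do not affect each other: both orders of sorting lead to this permutation. *)
  have [l wl] := sorted_word_total (adj i * (adj j * w)).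
  rewrite (IHi (s j * l)); last first.
    apply: sorted_word_descent; last by rewrite mulgA -adj_far ?far // -mulgA.
    by rewrite /descent !permM !(@adjD _ i) // -val_eqE /=; lia.
  rewrite (IHj (s i * l)); last first.
    apply: sorted_word_descent; last by [].
    by rewrite /descent !permM !(@adjD _ j) // -val_eqE /=; lia.
  by rewrite !mulgA s_far // far.
have hl := lo_hi near.
have ai : adj i (hi j) = hi j by rewrite adjD // -val_eqE /=; lia.
have aj : adj j (lo i) = lo i by rewrite adjD // -val_eqE /=; lia.
have ajh : adj j (hi i) = hi j by rewrite -hl adj_lo.
have aji : adj j (hi j) = hi i by rewrite -hl adj_hi.
have dij : w (hi j) < w (lo i).
  by move: di dj; rewrite /descent hl => di dj; exact: ltn_trans dj di.
(* The three values involved are in decreasing order, so sorting along i, j, i and along j, i, j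
   meets only descents and ends at the same permutation. *)
have [l wl] := sorted_word_total (adj i * (adj j * (adj i * w))).
rewrite (IHi (s j * (s i * l))); last first.
  apply: sorted_word_descent; first by rewrite /descent !permM ai hl adj_hi.
  apply: sorted_word_descent; last by [].
  by rewrite /descent !permM ajh aj ai adj_lo -hl.
rewrite (IHj (s i * (s j * l))); last first.
  apply: sorted_word_descent; first by rewrite /descent !permM aj ajh.
  apply: sorted_word_descent;
    first by rewrite /descent !permM hl adj_hi ai aji aj.
  by move: wl; rewrite !mulgA (adj_near near).
by rewrite !mulgA s_near.
Qed.

(** If [i] is a descent of [w], uniqueness of sorted words gives [S w = s i * S (adj i * w)];
    otherwise the same rule applies to [adj i * w]. With [ss], both cases say that [S] is compatible
    with left multiplication by generators. *)
Lemma coxeter_morphism : exists S : 'S_n -> M,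
  [/\ S 1 = 1, {morph S : v w / v * w} & forall i, S (adj i) = s i].
Proof.
have [S SP] := choice sorted_word_total.
have S1 : S 1 = 1 by apply: sorted_word_fun (SP 1) sorted_word1.
have Sdesc i w : descent i w -> S w = s i * S (adj i * w).
  move=> dw; apply: sorted_word_fun (SP w) _.
  exact: sorted_word_descent dw (SP _).
have Sadj i w : S (adj i * w) = s i * S w.
  have [dw|/descent_adj dw] := boolP (descent i w).
    by rewrite (Sdesc i w dw) mulgA ss mul1g.
  by rewrite (Sdesc _ _ dw) adjKw.
exists S; split=> // [v w|i]; last by rewrite -[adj i]mulg1 Sadj S1 mulg1.
elim/perm_adj_ind: v => [|i v IH]; first by rewrite S1 !mul1g.
by rewrite -mulgA !Sadj IH mulgA.
Qed.

End Coxeter.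

(** * The map from the abacus monoid *)

Section CommutingProducts.
Variables (M : monoidType) (T : finType).
Implicit Types (c : T -> M) (x : M).

Lemma perm_prod c (r1 r2 : seq T) : (forall i j, commute (c i) (c j)) ->
  perm_eq r1 r2 -> \prod_(i <- r1) c i = \prod_(i <- r2) c i.
Proof.
move=> cC eq_r; apply/catCA_perm_subst: r1 r2 eq_r => s1 s2 s3;
  rewrite !big_cat /= !mulgA.
congr (_ * _); apply: commute_prod => i _; apply: commute_sym.
by apply: commute_prod => j _.
Qed.

(** The counterpart of [bigD1] in a monoid that may be noncommutative: pairwise commutation of the
    factors replaces commutativity of the law. *)
Lemma prodD1 c i : (forall i j, commute (c i) (c j)) ->
  \prod_j c j = c i * \prod_(j | j != i) c j.
Proof.
move=> cC; rewrite -[in RHS]big_filter.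
have -> : [seq j <- index_enum T | j != i] = rem i (index_enum T).
  by rewrite rem_filter ?index_enum_uniq.
transitivity (\prod_(j <- i :: rem i (index_enum T)) c j); last exact: big_cons.
apply: perm_prod => //; exact: perm_to_rem (mem_index_enum i).
Qed.

(** Moving [x] through the factors one at a time leaves the family [c'] enumerated in the order
    given by [w]; commutation of [c'] restores the standard order. *)
Lemma prod_intertwine c c' x (w : {perm T}) :
  (forall i j, commute (c' i) (c' j)) ->
  (forall i, c i * x = x * c' (w i)) -> (\prod_i c i) * x = x * \prod_i c' i.
Proof.
move=> cC cx.
have -> : \prod_i c' i = \prod_i c' (w i).
  rewrite -[RHS](big_map w predT); apply: perm_prod => //.
  apply: uniq_perm; rewrite ?index_enum_uniq ?map_inj_uniq ?index_enum_uniq //.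
    exact: perm_inj.
  by move=> i; rewrite mem_index_enum -(permKV w i) map_f ?mem_index_enum.
elim: (index_enum T) => [|i r IH]; first by rewrite !big_nil mul1g mulg1.
by rewrite !big_cons -mulgA IH !mulgA cx.
Qed.

End CommutingProducts.

(** Induction on [r]: a permutation that is correct on the tail is followed by the transposition of
    [w x] and [f x], which by injectivity does not disturb the tail. *)
Lemma perm_extend (T : finType) (f : T -> T) (r : seq T) : uniq r ->
  {in r &, injective f} -> exists w : {perm T}, {in r, w =1 f}.
Proof.
elim: r => [|x r IH] /=; first by exists 1.
case/andP=> xr ur inj_f; have [|w wf] := IH ur.
  by move=> y z yr zr; apply: inj_f; rewrite inE ?yr ?zr orbT.
exists (w * tperm (w x) (f x)) => y; rewrite inE permM => /predU1P[->|yr].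
  by rewrite tpermL.
have nyx : y != x by apply: contraNneq xr => <-.
rewrite tpermD ?(inj_eq perm_inj) 1?eq_sym //; first exact: wf.
rewrite wf //; apply: contra nyx => /eqP fyx.
by apply/eqP/inj_f; rewrite ?inE ?yr ?eqxx ?orbT.
Qed.

(** This serves to conjugate an identity about two arbitrary points to one about the first two
    points, where it follows from a defining relation. *)
Lemma perm_adjacent_pair n (x y : 'I_n) : x != y ->
  exists (i : 'I_n.-1) (w : 'S_n),
    [/\ i = 0%N :> nat, w (lo i) = x & w (hi i) = y].
Proof.
move=> nxy; have n1 : 0 < n.-1.
  have := ltn_ord x; have := ltn_ord y.
  by have := nxy; rewrite -val_eqE /=; lia.
pose i := Ordinal n1; have hl : (hi i == lo i) = false by [].
have [|z t|w wf] := @perm_extend _ (fun z => if z == lo i then x else y)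
  [:: lo i; hi i].
- by [].
- rewrite !inE => /pred2P[]-> /pred2P[]-> //; rewrite eqxx hl => /eqP.
    by rewrite (negbTE nxy).
  by rewrite eq_sym (negbTE nxy).
exists i, w; split=> //; first by rewrite wf ?inE ?eqxx.
by rewrite wf ?inE ?eqxx ?orbT // hl.
Qed.

(** * Values of words in a monoid *)

Section Evaluation.
Variables (X : eqType) (M : monoidType) (e : X -> M).

Definition evalw (u : seq X) : M := \prod_(x <- u) e x.

Lemma evalw_cat u v : evalw (u ++ v) = evalw u * evalw v.
Proof. exact: big_cat. Qed.

Lemma evalw_cons x u : evalw (x :: u) = e x * evalw u.
Proof. exact: big_cons. Qed.

Lemma evalw0 : evalw [::] = 1.
Proof. exact: big_nil. Qed.

Lemma evalw1 x : evalw [:: x] = e x.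
Proof. by rewrite evalw_cons evalw0 mulg1. Qed.

Lemma evalw_nseq k x : evalw (nseq k x) = e x ^+ k.
Proof.
by elim: k => [|k IH]; rewrite ?evalw0 // evalw_cons IH expgS.
Qed.

Definition respects (R : seq X -> seq X -> Prop) :=
  forall u v, R u v -> evalw u = evalw v.

End Evaluation.

(** Compatibility with left multiplication by generators suffices, and it is what can be checked
    directly for a map defined through normal forms. *)
Lemma morphism_evalw (X : eqType) (M N : monoidType) (f : M -> N)
    (e : X -> M) (e' : X -> N) : f 1 = 1 ->
  (forall x a, f (e x * a) = e' x * f a) ->
  forall u, f (evalw e u) = evalw e' u.
Proof.
move=> f1 fM; elim=> [|x u IH]; first by rewrite !evalw0.
by rewrite !evalw_cons fM IH.
Qed.

Section AbacusGenerators.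
Variables (n d : nat) (i : 'I_n.-1) (x j : 'I_n).

Lemma dn_s : dn (abacus_s d i) j = Some (adj i j).
Proof. by rewrite /dn /= ffunE. Qed.
Lemma up_s : up (abacus_s d i) j = Some (adj i j).
Proof. by rewrite /up /= ffunE. Qed.
Lemma topb_s : topb (abacus_s d i) j = 0%R.
Proof. by rewrite /topb /= ffunE. Qed.
Lemma botb_s : botb (abacus_s d i) j = 0%R.
Proof. by rewrite /botb /= ffunE. Qed.

Lemma dn_r : dn (abacus_r d x) j = if j == x then None else Some j.
Proof. by rewrite /dn /= ffunE. Qed.
Lemma up_r : up (abacus_r d x) j = if j == x then None else Some j.
Proof. by rewrite /up /= ffunE. Qed.
Lemma topb_r : topb (abacus_r d x) j = 0%R.
Proof. by rewrite /topb /= ffunE. Qed.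
Lemma botb_r : botb (abacus_r d x) j = 0%R.
Proof. by rewrite /botb /= ffunE. Qed.

Lemma dn_o : dn (abacus_o d x) j = Some j.
Proof. by rewrite /dn /= ffunE. Qed.
Lemma up_o : up (abacus_o d x) j = Some j.
Proof. by rewrite /up /= ffunE. Qed.
Lemma topb_o : topb (abacus_o d x) j = if j == x then inZp 1 else 0%R.
Proof. by rewrite /topb /= ffunE. Qed.
Lemma botb_o : botb (abacus_o d x) j = if j == x then inZp 1 else 0%R.
Proof. by rewrite /botb /= ffunE. Qed.

End AbacusGenerators.

Section PermutationExtension.
Variables (n d : nat).
Implicit Types (w : 'S_n) (a : abacus n d).

Definition extends w a := forall j k, dn a j = Some k -> w j = k.

Lemma extends_exists a : exists w, extends w a.
Proof.
have [|j k|w wf] := @perm_extend _ (fun j => odflt j (dn a j))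
    [seq j <- enum 'I_n | dn a j != None].
- by rewrite filter_uniq ?enum_uniq.
- rewrite !mem_filter; case Ej: (dn a j) => [x|] //= _.
  case Ek: (dn a k) => [y|] //= _ xy; rewrite xy in Ej.
  by move: Ej Ek => /dn_up Ej /dn_up; rewrite Ej => -[].
exists w => j k jk; rewrite wf ?jk //.
by rewrite mem_filter jk mem_enum.
Qed.

Lemma extends_up w a j k : extends w a -> up a k = Some j -> w^-1 k = j.
Proof. by move=> wa /dn_up/wa <-; rewrite permK. Qed.

End PermutationExtension.

(** * Normal forms of abaci in a monoid satisfying the relations *)

Section FromAbacus.
Variables (n d : nat) (M : monoidType) (e : gen n -> M).
Hypothesis d_gt0 : 0 < d.
Hypothesis e_rel : respects e (@abacus_rel n d).
Implicit Types (i : 'I_n.-1) (j k x y : 'I_n) (w : 'S_n) (a : abacus n d).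
Implicit Types (u : 'I_n -> nat) (A : 'I_n -> bool).

Let s i := e (gs i).
Let r j := e (gp j).
Let o j := e (gz j).

Let ss i : s i * s i = 1.
Proof. by have := e_rel (ar_ss d i); rewrite !evalw_cons evalw0 mulg1. Qed.

Let s_far i i' : (i.+1 < i') || (i'.+1 < i) -> s i * s i' = s i' * s i.
Proof. by move/ar_sC => /(_ d)/e_rel; rewrite !evalw_cons evalw0 !mulg1. Qed.

Let s_near i i' : i.+1 = i' -> s i * s i' * s i = s i' * s i * s i'.
Proof.
move=> ii'; have: (i.+1 == i') || (i'.+1 == i) by rewrite ii' eqxx.
by move/ar_sB => /(_ d)/e_rel; rewrite !evalw_cons evalw0 !mulg1 !mulgA.
Qed.

Let rC j k : commute (r j) (r k).
Proof. by have := e_rel (ar_rC d j k); rewrite !evalw_cons evalw0 !mulg1. Qed.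

Let rs i j : r j * s i = s i * r (adj i j).
Proof.
have [->|jl] := eqVneq j (lo i); last have [->|jh] := eqVneq j (hi i).
- rewrite adj_lo; have := e_rel (ar_rslo d i).
  by rewrite !evalw_cons evalw0 !mulg1.
- rewrite adj_hi; have := e_rel (ar_rshi d i).
  by rewrite !evalw_cons evalw0 !mulg1.
rewrite adjD //; have := e_rel (ar_rs d jl jh).
by rewrite !evalw_cons evalw0 !mulg1.
Qed.

Let rsr i : r (lo i) * s i * r (lo i) = r (lo i) * r (hi i).
Proof.
by have := e_rel (ar_rsr d i); rewrite !evalw_cons evalw0 !mulg1 !mulgA.
Qed.

Let od j : o j ^+ d = 1.
Proof. by have := e_rel (ar_od d j); rewrite evalw_nseq evalw0. Qed.

Let oC j k : commute (o j) (o k).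
Proof. by have := e_rel (ar_oC d j k); rewrite !evalw_cons evalw0 !mulg1. Qed.

Let os i j : o j * s i = s i * o (adj i j).
Proof. by have := e_rel (ar_os d i j); rewrite !evalw_cons evalw0 !mulg1. Qed.

Let ro j k : j != k -> commute (r j) (o k).
Proof. by move/ar_ro => /(_ d)/e_rel; rewrite !evalw_cons evalw0 !mulg1. Qed.

Let ror j m : r j * o j ^+ m * r j = r j.
Proof.
have := e_rel (ar_ror d j m);
  rewrite !evalw_cons evalw_cat evalw_nseq !evalw_cons.
by rewrite evalw0 !mulg1 mulgA.
Qed.

Let o_mod j m : o j ^+ (m %% d) = o j ^+ m.
Proof.
by rewrite {2}(divn_eq m d) expgnDr mulnC expgnA od expg1n mul1g.
Qed.

Variable S : 'S_n -> M.
Hypothesis S1 : S 1 = 1.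
Hypothesis SM : {morph S : v w / v * w}.
Hypothesis Sadj : forall i, S (adj i) = s i.

(** The commutation rule passes from adjacent transpositions to the permutations they generate. *)
Let intertwine (c : 'I_n -> M) w j :
  (forall i k, c k * s i = s i * c (adj i k)) -> c j * S w = S w * c (w j).
Proof.
move=> cs; elim/perm_adj_ind: w j => [|i w IH] j.
  by rewrite S1 perm1 mulg1 mul1g.
by rewrite SM Sadj mulgA cs -mulgA IH mulgA permM.
Qed.

Let rS w j : r j * S w = S w * r (w j).
Proof. by apply: (@intertwine r) => *; apply: rs. Qed.

Let oXs m i j : o j ^+ m * s i = s i * o (adj i j) ^+ m.
Proof.
elim: m => [|m IH]; first by rewrite !expg0 mul1g mulg1.
by rewrite !expgS -mulgA IH !mulgA os.
Qed.

Let oXS m w j : o j ^+ m * S w = S w * o (w j) ^+ m.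
Proof. by apply: (@intertwine (fun j => o j ^+ m)) => *; apply: oXs. Qed.

(** For adjacent points, moving [s i] to the left of the second cut turns the product into
    [r (lo i) * s i * r (lo i)], which is [rsr]. The general case is a conjugate of this one. *)
Let rr_tperm x y : x != y -> r x * r y * S (tperm x y) = r x * r y.
Proof.
move=> /perm_adjacent_pair[i [w [_ wl wh]]].
have -> : tperm x y = w^-1 * adj i * w.
  by rewrite -mulgA -conjgE tpermJ wl wh.
have rrS v z t : r z * r t * S v = S v * (r (v z) * r (v t)).
  by rewrite -mulgA rS mulgA rS mulgA.
have rrs : r (lo i) * r (hi i) * s i = r (lo i) * r (hi i).
  by rewrite -mulgA rs adj_hi mulgA rsr.
rewrite !SM !mulgA rrS -wl -wh !permK Sadj -(mulgA _ _ (s i)) rrs wl wh.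
by rewrite -mulgA rrS wl wh mulgA -SM mulVg S1 mul1g.
Qed.

(** [u] counts beads and [A] marks the cut strands; the beads stand above the cut, hence stay on the
    broken arc at the top. *)
Definition top_factor u A j : M := o j ^+ u j * (if A j then r j else 1).

Definition top_part u A : M := \prod_j top_factor u A j.

Definition bottom_part u : M := \prod_j o j ^+ u j.

Let topC u A j k : commute (top_factor u A j) (top_factor u A k).
Proof.
have [->//|njk] := eqVneq j k.
have oo : commute (o j ^+ u j) (o k ^+ u k) by exact/commuteX2/oC.
have or_ : commute (o j ^+ u j) (if A k then r k else 1).
  by case: ifP => _; [apply/commute_sym/commuteX/ro;
    rewrite eq_sym | apply: commute1].
have ro_ : commute (if A j then r j else 1) (o k ^+ u k).
  case: ifP => _; [exact/commuteX/ro | exact/commute_sym/commute1].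
have rr_ : commute (if A j then r j else 1) (if A k then r k else 1).
  by case: ifP; case: ifP => _ _; rewrite /commute ?mul1g ?mulg1 //; exact: rC.
apply: commuteM; apply: commute_sym; apply: commuteM; exact: commute_sym.
Qed.

Let bottomC u j k : commute (o j ^+ u j) (o k ^+ u k).
Proof. exact/commuteX2/oC. Qed.

Let eq_bottom u u' : u =1 u' -> bottom_part u = bottom_part u'.
Proof. by move=> eu; apply: eq_bigr => j _; rewrite eu. Qed.

Let top_tperm u A x y : A x -> A y ->
  top_part u A * S (tperm x y) = top_part u A.
Proof.
have [->|nxy] := eqVneq x y; first by rewrite tperm1 S1 mulg1.
move=> Ax Ay.
have topD c B : commute (top_factor u A c) (\prod_(j | B j) top_factor u A j).
  by apply: commute_prod => j _.
(* The factors at [x] and [y] are brought to the right end, next to the transposition that they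
   absorb. *)
have -> : top_part u A =
    \prod_(j | (j != y) && (j != x)) top_factor u A j *
      (top_factor u A x * top_factor u A y).
  rewrite /top_part (prodD1 x) // big_mkcond /=.
  rewrite (prodD1 y) => [|j k]; last first.
    by case: ifP; case: ifP => _ _; rewrite /commute ?mul1g ?mulg1 //;
      exact: topC.
  rewrite eq_sym nxy -big_mkcondr /=.
  rewrite mulgA; apply: commute_sym.
  by apply: commuteM; apply/commute_sym/topD.
rewrite -mulgA; congr (_ * _); rewrite /top_factor Ax Ay.
have -> : o x ^+ u x * r x * (o y ^+ u y * r y) =
          o x ^+ u x * o y ^+ u y * (r x * r y).
  rewrite -!mulgA; congr (_ * _); rewrite !mulgA; congr (_ * _).
  exact/commuteX/ro.
by rewrite -mulgA rr_tperm.
Qed.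

(** Induction on the number of moved points. If [w] moves x, then x and y = w^-1 x are both cut;
    splitting off their transposition, which is absorbed, leaves a permutation that fixes x and
    moves no new point. *)
Let top_absorb u A w : (forall j, ~~ A j -> w j = j) ->
  top_part u A * S w = top_part u A.
Proof.
have [m] := ubnP #|[pred j | w j != j]|; elim: m w => // m IH w lt_wm fix_w.
have [/existsP[x wx]|/existsPn fw] := boolP [exists x, w x != x]; last first.
  have -> : w = 1 by apply/permP => x; rewrite perm1; apply/eqP/negbNE.
  by rewrite S1 mulg1.
pose y := w^-1 x; have wy : w y = x by rewrite permKV.
have nyx : y != x by apply: contraNneq wx => yx; rewrite -{1}yx wy.
have Ax : A x by apply: contraNT wx => /fix_w ->.
have Ay : A y by apply: contraNT nyx => /fix_w <-; rewrite wy.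
have tK : tperm x y * (tperm x y * w) = w by rewrite mulgA tperm2 mul1g.
rewrite -tK SM mulgA top_tperm //; apply: IH => [|j Aj]; last first.
  by rewrite permM tpermD ?fix_w //; apply: contraNneq Aj => <-.
apply: leq_trans (lt_wm : _ <= m); apply: proper_card; apply/properP; split.
  apply/fintype.subsetP => j; rewrite !inE permM.
  by case: tpermP => [->|->|//]; rewrite wy ?eqxx // => _; rewrite eq_sym.
by exists x; rewrite !inE // permM tpermL wy eqxx.
Qed.

Let top_eq u A w w' : (forall j, ~~ A j -> w j = w' j) ->
  top_part u A * S w = top_part u A * S w'.
Proof.
move=> ww'; rewrite -{1}(mulgVK w' w) SM mulgA (@top_absorb _ _ (w / w')) //
  => j /ww' ew.
by rewrite permM ew permK.
Qed.

(** The beads of a line are recorded at both of its ends. They enter through the top part only, so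
    the bottom part is restricted to broken arcs. *)
Definition normal_form w a : M :=
  top_part (fun j => topb a j) (fun j => dn a j == None) * S w *
  bottom_part (fun k => if up a k is None then botb a k else 0%N).

Let normal_form_indep w w' a : extends w a -> extends w' a ->
  normal_form w a = normal_form w' a.
Proof.
move=> wa w'a; congr (_ * _); apply: top_eq => j.
by case E: (dn a j) => [k|] // _; rewrite (wa _ _ E) (w'a _ _ E).
Qed.

Let normal_form_s i w a : extends w a ->
  extends (adj i * w) (abacus_s d i * a) /\
  normal_form (adj i * w) (abacus_s d i * a) = s i * normal_form w a.
Proof.
move=> wa; have dns j : dn (abacus_s d i * a) j = dn a (adj i j).
  by rewrite dn_mul dn_s.
split=> [j k|]; first by rewrite dns permM => /wa.
rewrite /normal_form SM Sadj !mulgA; congr (_ * _); last first.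
  apply: eq_bottom => k; rewrite up_mul botb_mul.
  case: (up a k) => [j|]; last by rewrite add0r.
  by rewrite /= up_s.
congr (_ * _); apply: (@prod_intertwine _ _ _ _ _ (adj i)) => //.
move=> j; rewrite /top_factor dns topb_mul.
rewrite topb_s dn_s add0r mulgA -oXs -!mulgA; congr (_ * _).
by case: ifP => _; rewrite ?rs ?mul1g ?mulg1.
Qed.

Let o_modS j m : o j ^+ (m %% d.-1.+1) = o j ^+ m.
Proof. by rewrite prednK ?o_mod. Qed.

Let o_val j (m m' : beads d) : o j ^+ (m + m')%R = o j ^+ m * o j ^+ m'.
Proof. by rewrite -expgnDr -[RHS]o_modS. Qed.

Let normal_form_o (i : 'I_n) w a : extends w a ->
  extends w (abacus_o d i * a) /\
  normal_form w (abacus_o d i * a) = o i * normal_form w a.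
Proof.
move=> wa; have dno j : dn (abacus_o d i * a) j = dn a j.
  by rewrite dn_mul dn_o.
split=> [j k|]; first by rewrite dno => /wa.
rewrite /normal_form !mulgA; congr (_ * _); last first.
  apply: eq_bottom => k; rewrite up_mul botb_mul.
  case: (up a k) => [j|]; last by rewrite add0r.
  by rewrite /= up_o.
congr (_ * _); rewrite /top_part (prodD1 i) // [in RHS](prodD1 i) // mulgA.
congr (_ * _); rewrite /top_factor.
  rewrite dno topb_mul mulgA; congr (_ * _).
  rewrite dn_o topb_o eqxx o_val; congr (_ * _).
  by rewrite /= o_modS expg1.
apply: eq_bigr => j /negbTE ji; rewrite dno topb_mul.
by rewrite dn_o topb_o ji add0r.
Qed.

Let normal_form_r (i : 'I_n) w a : extends w a ->
  extends w (abacus_r d i * a) /\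
  normal_form w (abacus_r d i * a) = r i * normal_form w a.
Proof.
move=> wa; have dnr j :
    dn (abacus_r d i * a) j = if j == i then None else dn a j.
  by rewrite dn_mul dn_r; case: eqP.
have tbr j : topb (abacus_r d i * a) j = if j == i then 0%R else topb a j.
  rewrite topb_mul dn_r topb_r.
  by case: eqP; rewrite ?add0r ?addr0.
have upr k : up (abacus_r d i * a) k = if up a k == Some i then None else up a
  k.
  rewrite up_mul; case: (up a k) => //= j; rewrite up_r.
  by rewrite (inj_eq (@Some_inj _)); case: eqP.
have bbr k : botb (abacus_r d i * a) k = botb a k.
  rewrite botb_mul; case: (up a k) => [j|]; last by rewrite add0r.
  by rewrite botb_r add0r.
split=> [j k|]; first by rewrite dnr; case: eqP => // _ /wa.
rewrite /normal_form /top_part (prodD1 i) // [in RHS](prodD1 i) //.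
have -> : \prod_(j | j != i) top_factor (fun j => topb (abacus_r d i * a) j)
      (fun j => dn (abacus_r d i * a) j == None) j =
    \prod_(j | j != i) top_factor (fun j => topb a j) (fun j => dn a j ==
      None) j.
  by apply: eq_bigr => j /negbTE ji; rewrite /top_factor dnr tbr ji.
set P := (X in _ * X * S w * bottom_part _ = _).
rewrite {1 2}/top_factor dnr tbr eqxx eqxx expg0 mul1g.
case E: (dn a i) => [k|] /=; last first.
  (* Strand [i] is already cut: its beads now lie on an arc with two free ends, and [ror] discards
     them. *)
  rewrite !mulgA ror; congr (_ * _); apply: eq_bottom => k.
  rewrite upr bbr; case: eqP => [/dn_up|//].
  by rewrite E.
(* Cutting the line from [i] to [k] leaves its beads on the new broken arc at the bottom point
   [k]. *)
have -> : bottom_part (fun k0 =>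
      if up (abacus_r d i * a) k0 is None then botb (abacus_r d i * a) k0 else
        0%N)
    = o k ^+ topb a i *
      bottom_part (fun k0 => if up a k0 is None then botb a k0 else 0%N).
  rewrite /bottom_part (prodD1 k (bottomC _)) [in RHS](prodD1 k (bottomC _))
    mulgA.
  have /dn_up Ek := E; congr (_ * _).
    by rewrite upr bbr Ek eqxx mulg1 (topb_botb E).
  apply: eq_bigr => j jk; rewrite upr bbr; case: eqP => // /dn_up.
  by rewrite E => -[kj]; rewrite kj eqxx in jk.
have oP : commute (o i ^+ topb a i) P.
  apply: commute_prod => j ji; rewrite /top_factor; apply: commuteM.
    exact/commuteX2/oC.
  by case: ifP => _; [exact/commute_sym/commuteX/ro|exact: commute1].
rewrite mulg1 !mulgA; congr (_ * _).
(* In [M] these beads move down past [P] and then past [S w], which carries strand [i] to [k]. *)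
by rewrite -!mulgA -(wa _ _ E) -oXS !mulgA -[r i * P * _]mulgA -oP !mulgA.
Qed.

Let normal_form_1 : extends 1 (1 : abacus n d) /\
  normal_form 1 (1 : abacus n d) = 1.
Proof.
split=> [j k|]; first by rewrite dn_one perm1 => -[].
rewrite /normal_form S1 mulg1 [X in X * _]big1 => [|j _].
  by rewrite mul1g; apply: big1 => k _; rewrite up_one expg0.
by rewrite /top_factor topb_one dn_one mulg1 expg0.
Qed.

Lemma normal_form_gen : exists f : abacus n d -> M,
  f 1 = 1 /\ forall (x : gen n) a, f (abacus_gen d x * a) = e x * f a.
Proof.
(* The extension chosen for a product may differ from the one computed from its factors;
   [normal_form_indep] reconciles them. *)
have [W WP] := choice (@extends_exists n d).
exists (fun a => normal_form (W a) a); split=> [|x a].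
  by have [w1 <-] := normal_form_1; apply: normal_form_indep.
case: x => i /=.
- have [w1 <-] := normal_form_s i (WP a); exact: normal_form_indep.
- have [w1 <-] := normal_form_r i (WP a); exact: normal_form_indep.
- have [w1 <-] := normal_form_o i (WP a); exact: normal_form_indep.
Qed.

End FromAbacus.

Lemma abacus_evaluation (n d : nat) (M : monoidType) (e : gen n -> M) :
  0 < d -> respects e (@abacus_rel n d) ->
  exists f : abacus n d -> M,
    f 1 = 1 /\ forall (x : gen n) a, f (abacus_gen d x * a) = e x * f a.
Proof.
move=> d_gt0 e_rel.
have [||| S [S1 SM Sadj]] := @coxeter_morphism n M (fun i => e (gs i)).
- by move=> i; have := e_rel _ _ (ar_ss d i); rewrite !evalw_cons evalw0 mulg1.
- move=> i j /ar_sC => /(_ d)/e_rel.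
  by rewrite !evalw_cons evalw0 !mulg1.
- move=> i j ij; have: (i.+1 == j) || (j.+1 == i) by rewrite ij eqxx.
  by move/ar_sB => /(_ d)/e_rel; rewrite !evalw_cons evalw0 !mulg1 !mulgA.
exact: (normal_form_gen d_gt0 e_rel S1 SM Sadj).
Qed.

(** * Diagrams *)

Section AbacusDiagrams.
Variables n d : nat.
Implicit Types (i : 'I_n.-1) (j k x : 'I_n) (v w : 'S_n) (A B : seq 'I_n).
Implicit Types (t u : {ffun 'I_n -> beads d}) (a : abacus n d).

(** Diagrams with only beads, only cuts or only a permutation multiply by adding, concatenating or
    composing their parameters; relations are then verified on the parameters. *)
Fact bead_diagram_subproof u :
  abacus_axiom ([ffun j => Some j], [ffun j => Some j], u, u).
Proof. by apply: abacus_axiomP => j k; rewrite !ffunE;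
  [split=> -[->]|case=> ->]. Qed.
Definition bead_diagram u : abacus n d := Abacus (bead_diagram_subproof u).

Fact cut_diagram_subproof A : @abacus_axiom n d
  ([ffun j => if j \in A then None else Some j],
   [ffun j => if j \in A then None else Some j], [ffun=> 0%R], [ffun=> 0%R]).
Proof.
apply: abacus_axiomP => j k; rewrite !ffunE //.
by split; case: ifP => // E [<-]; rewrite E.
Qed.
Definition cut_diagram A : abacus n d := Abacus (cut_diagram_subproof A).

Fact perm_diagram_subproof w : @abacus_axiom n d
  ([ffun j => Some (w j)], [ffun j => Some (w^-1 j)], [ffun=> 0%R], [ffun=>
    0%R]).
Proof.
apply: abacus_axiomP => j k; rewrite !ffunE //.
by split=> -[<-]; rewrite ?permK ?permKV.
Qed.
Definition perm_diagram w : abacus n d := Abacus (perm_diagram_subproof w).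

Lemma dn_bead u j : dn (bead_diagram u) j = Some j.
Proof. by rewrite /dn /= ffunE. Qed.
Lemma up_bead u j : up (bead_diagram u) j = Some j.
Proof. by rewrite /up /= ffunE. Qed.
Lemma topb_bead u j : topb (bead_diagram u) j = u j. Proof. by []. Qed.
Lemma botb_bead u j : botb (bead_diagram u) j = u j. Proof. by []. Qed.

Lemma dn_cut A j : dn (cut_diagram A) j = if j \in A then None else Some j.
Proof. by rewrite /dn /= ffunE. Qed.
Lemma up_cut A j : up (cut_diagram A) j = if j \in A then None else Some j.
Proof. by rewrite /up /= ffunE. Qed.
Lemma topb_cut A j : topb (cut_diagram A) j = 0%R.
Proof. by rewrite /topb /= ffunE. Qed.
Lemma botb_cut A j : botb (cut_diagram A) j = 0%R.
Proof. by rewrite /botb /= ffunE. Qed.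

Lemma dn_perm w j : dn (perm_diagram w) j = Some (w j).
Proof. by rewrite /dn /= ffunE. Qed.
Lemma up_perm w j : up (perm_diagram w) j = Some (w^-1 j).
Proof. by rewrite /up /= ffunE. Qed.
Lemma topb_perm w j : topb (perm_diagram w) j = 0%R.
Proof. by rewrite /topb /= ffunE. Qed.
Lemma botb_perm w j : botb (perm_diagram w) j = 0%R.
Proof. by rewrite /botb /= ffunE. Qed.

Local Opaque bead_diagram cut_diagram perm_diagram.
Local Opaque abacus_mul abacus_one abacus_s abacus_r abacus_o.

Definition dnE := (dn_mul, dn_one, dn_bead, dn_cut, dn_perm, dn_s, dn_r, dn_o).
Definition upE := (up_mul, up_one, up_bead, up_cut, up_perm, up_s, up_r, up_o).
Definition topbE :=
  (topb_mul, topb_one, topb_bead, topb_cut, topb_perm, topb_s, topb_r, topb_o).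
Definition botbE :=
  (botb_mul, botb_one, botb_bead, botb_cut, botb_perm, botb_s, botb_r, botb_o).

Lemma bead_diagram0 : bead_diagram 0%R = 1.
Proof. by apply: abacus_eq => j; rewrite ?(dnE, upE, topbE, botbE) ?ffunE. Qed.

Lemma bead_diagramD t u :
  bead_diagram (t + u)%R = bead_diagram t * bead_diagram u.
Proof.
by apply: abacus_eq => j;
  rewrite ?(dnE, upE, topbE, botbE) ?ffunE //= ?dnE ?upE.
Qed.

Lemma cut_diagram0 : cut_diagram [::] = 1.
Proof. by apply: abacus_eq => j; rewrite ?(dnE, upE, topbE, botbE). Qed.

Lemma cut_diagram_cat A B : cut_diagram (A ++ B) = cut_diagram A * cut_diagram
  B.
Proof.
apply: abacus_eq => j; rewrite ?(dnE, upE, topbE, botbE) ?mem_cat.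
- by case: (j \in A) => //=; rewrite dnE.
- by case: (j \in B); rewrite ?orbT ?orbF //= upE.
- by case: ifP; rewrite ?topbE addr0.
- by case: ifP; rewrite ?botbE addr0.
Qed.

Lemma eq_cut_diagram A B : A =i B -> cut_diagram A = cut_diagram B.
Proof. by move=> AB; apply: abacus_eq => j;
  rewrite ?(dnE, upE, topbE, botbE) ?AB. Qed.

Lemma perm_diagram1 : perm_diagram 1 = 1.
Proof.
by apply: abacus_eq => j; rewrite ?(dnE, upE, topbE, botbE) ?invg1 ?perm1.
Qed.

Lemma perm_diagramM v w : perm_diagram (v * w) = perm_diagram v * perm_diagram
  w.
Proof.
apply: abacus_eq => j; rewrite ?(dnE, upE, topbE, botbE) ?addr0 //=.
  by rewrite dnE permM.
by rewrite upE invgM permM.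
Qed.

Lemma cut_permC A w :
  cut_diagram A * perm_diagram w = perm_diagram w * cut_diagram (map w A).
Proof.
have mem_wA j : (w j \in map w A) = (j \in A) by rewrite mem_map //;
  apply: perm_inj.
apply: abacus_eq => j;
  rewrite ?(dnE, upE, topbE, botbE) /= ?(dnE, upE, topbE, botbE).
- by rewrite mem_wA; case: ifP => //= _; rewrite dnE.
- by rewrite -[in RHS](permKV w j) mem_wA permKV; case: ifP => //= _;
    rewrite upE.
- by case: ifP; rewrite ?topbE !addr0.
- by case: ifP; rewrite ?botbE !addr0.
Qed.

Lemma perm_cut w A : (forall j, j \notin A -> w j = j) ->
  perm_diagram w * cut_diagram A = cut_diagram A.
Proof.
move=> fw; have fw' j : j \notin A -> w^-1 j = j by move/fw => {1}<-;
  rewrite permK.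
have wA j : (w j \in A) = (j \in A).
  apply/idP/idP; apply: contraLR => jA; first by rewrite fw.
  by have /perm_inj wj := fw _ jA; rewrite -wj.
apply: abacus_eq => j;
  rewrite ?(dnE, upE, topbE, botbE) /= ?(dnE, upE, topbE, botbE).
- by rewrite wA; case: ifPn => // /fw ->.
- by case: ifPn => //= jA; rewrite upE fw'.
- by rewrite addr0.
- by case: ifP; rewrite ?botbE addr0.
Qed.

Lemma bead_permC u w :
  bead_diagram u * perm_diagram w =
  perm_diagram w * bead_diagram [ffun j => u (w^-1 j)].
Proof.
apply: abacus_eq => j;
  rewrite ?(dnE, upE, topbE, botbE) /= ?(dnE, upE, topbE, botbE) //.
  by rewrite ffunE permK addrC.
by rewrite ffunE addrC.
Qed.

Lemma bead_cutC u A : (forall j, j \in A -> u j = 0%R) ->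
  cut_diagram A * bead_diagram u = bead_diagram u * cut_diagram A.
Proof.
move=> uA.
apply: abacus_eq => j;
  rewrite ?(dnE, upE, topbE, botbE) /= ?(dnE, upE, topbE, botbE).
- by case: ifP => //= _; rewrite dnE.
- by case: ifP => //= _; rewrite upE.
- by case: ifP => [/uA ->|_]; rewrite ?topbE ?addr0 ?add0r.
- by case: ifP => [/uA ->|_]; rewrite ?botbE ?addr0 ?add0r.
Qed.

(** The beads lie on strands cut both above and below, hence on arcs with two free ends, which are
    discarded. *)
Lemma cut_bead_cutl u A B : {subset A <= B} ->
  (forall j, j \notin A -> u j = 0%R) ->
  cut_diagram A * bead_diagram u * cut_diagram B = cut_diagram B.
Proof.
move=> AB uA; apply: abacus_eq => j; rewrite ?(dnE, upE, topbE, botbE).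
- case: ifPn => jA /=; rewrite ?dnE /= ?dnE; first by rewrite AB.
  by [].
- case: ifPn => jB //=; rewrite !upE /= upE.
  by rewrite (negbTE (contra (AB j) jB)).
- case: ifPn => jA /=; rewrite ?(dnE, topbE) ?addr0 //=.
  by rewrite ?(dnE, topbE) uA ?addr0.
- case: ifPn => jB; rewrite ?addr0 // botbE upE botbE.
  by rewrite uA ?addr0 ?(contra (AB j)) //; case: ifP; rewrite ?botbE ?addr0.
Qed.

Lemma cut_bead_cutr u A B : {subset A <= B} ->
  (forall j, j \notin A -> u j = 0%R) ->
  cut_diagram B * bead_diagram u * cut_diagram A = cut_diagram B.
Proof.
move=> AB uA; apply: abacus_eq => j; rewrite ?(dnE, upE, topbE, botbE).
- case: ifPn => jB //=; rewrite dnE /= dnE.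
  by rewrite (negbTE (contra (AB j) jB)).
- case: ifPn => jA /=; rewrite ?upE /= ?upE; first by rewrite AB.
  by [].
- case: ifPn => jB /=; rewrite ?(dnE, topbE) ?addr0 //=.
  by rewrite ?(dnE, topbE) uA ?addr0 ?(contra (AB j)).
- case: ifPn => jA; rewrite ?addr0 // botbE upE botbE.
  by rewrite uA ?addr0 //; case: ifP; rewrite ?botbE ?addr0.
Qed.

Lemma abacus_sE i : abacus_s d i = perm_diagram (adj i).
Proof.
apply: abacus_eq => j; rewrite ?(dnE, upE, topbE, botbE) //.
by rewrite /adj tpermV.
Qed.

Lemma abacus_rE j : abacus_r d j = cut_diagram [:: j].
Proof. by apply: abacus_eq => k; rewrite ?(dnE, upE, topbE, botbE) ?inE. Qed.

Definition single j (m : nat) : {ffun 'I_n -> beads d} :=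
  [ffun k => if k == j then inZp m else 0%R].

Lemma abacus_oE j : abacus_o d j = bead_diagram (single j 1).
Proof. by apply: abacus_eq => k; rewrite ?(dnE, upE, topbE, botbE) ?ffunE. Qed.

Lemma singleS j m : single j m.+1 = (single j 1 + single j m)%R.
Proof.
apply/ffunP => k; rewrite !ffunE; case: eqP => _; last by rewrite addr0.
by apply: val_inj; rewrite /= modnDm.
Qed.

Lemma single0 j : single j 0 = 0%R.
Proof. by apply/ffunP => k; rewrite !ffunE; case: eqP => // _;
  apply: val_inj. Qed.

Lemma abacus_oX j m : abacus_o d j ^+ m = bead_diagram (single j m).
Proof.
elim: m => [|m IH]; first by rewrite single0 bead_diagram0.
by rewrite expgS IH abacus_oE -bead_diagramD -singleS.
Qed.

(** This is the diagrammatic counterpart of [normal_form]; it shows that the generators generate. *)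
Lemma abacus_decomposition w a : extends w a ->
  a = bead_diagram (topb a) * cut_diagram [seq j <- enum 'I_n | dn a j == None]
      * perm_diagram w
      * bead_diagram [ffun k => if up a k is None then botb a k else 0%R].
Proof.
move=> wa; have upw := extends_up wa.
have mem_cut j : (j \in [seq j <- enum 'I_n | dn a j == None]) = (dn a j ==
  None).
  by rewrite mem_filter mem_enum andbT.
have up_cut_None j k : up a j = Some k -> (dn a k == None) = false.
  by move/dn_up => ->.
apply: abacus_eq => j.
- rewrite !dnE /= !dnE mem_cut; case E: (dn a j) => [k|] //=.
  by rewrite /= !dnE /= dnE (wa _ _ E).
- do 4!rewrite ?upE /=; rewrite mem_cut; case E: (up a j) => [k|] /=.
    by rewrite (upw _ _ E) (up_cut_None _ _ E) /= upE.
  (* A line starting at [w^-1 j] would end at [j], because [w] extends [a]; but [j] lies on a broken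
     arc. *)
  case: ifPn => //; case F: (dn a (w^-1 j)) => [k|] // _.
  by have := wa _ _ F; rewrite permKV => kj; move: F; rewrite -kj => /dn_up;
    rewrite E.
- do 4!rewrite ?(dnE, topbE) /=; rewrite mem_cut.
  case E: (dn a j) => [k|] /=; rewrite ?addr0 // dnE !topbE ffunE (wa _ _ E).
  by move/dn_up: E => ->; rewrite !addr0.
- do 6!rewrite ?(upE, botbE) /=; rewrite mem_cut !addr0 ffunE.
  case E: (up a j) => [k|] /=.
    rewrite (upw _ _ E) (up_cut_None _ _ E) botbE addr0.
    by move/dn_up: E => /topb_botb.
  case: ifPn => [_|]; first by rewrite add0r.
  case F: (dn a (w^-1 j)) => [k|] // _.
  by have := wa _ _ F; rewrite permKV => kj; move: F; rewrite -kj => /dn_up;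
    rewrite E.
Qed.

End AbacusDiagrams.

(** * Relations between diagrams *)

Section AbacusRelations.
Variables n d : nat.
Implicit Types (i : 'I_n.-1) (j k x : 'I_n) (w : 'S_n) (A : seq 'I_n).
Implicit Types (u : {ffun 'I_n -> beads d}) (a b : abacus n d).

Lemma abacus_generated a : exists g, a = evalw (@abacus_gen n d) g.
Proof.
pose G b := exists g, b = evalw (@abacus_gen n d) g.
have G1 : G 1 by exists [::]; rewrite evalw0.
have GM b c : G b -> G c -> G (b * c).
  by move=> [g ->] [h ->]; exists (g ++ h); rewrite evalw_cat.
have Ggen g : G (abacus_gen d g) by exists [:: g]; rewrite evalw1.
have Gbead u : G (bead_diagram u).
  have -> : u = (\sum_j single d j (u j))%R.
    apply/ffunP => k; rewrite sum_ffunE (bigD1 k) //= big1 => [|j jk].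
      by rewrite ffunE eqxx addr0 valZpK.
    by rewrite ffunE eq_sym (negbTE jk).
  elim/big_ind: _ => [|t v Gt Gv|j _]; first by rewrite bead_diagram0.
    by rewrite bead_diagramD; apply: GM.
  rewrite -abacus_oX -(evalw_nseq (@abacus_gen n d) _ (gz j)).
  by exists (nseq (u j) (gz j)).
have Gcut A : G (cut_diagram d A).
  elim: A => [|j A IH]; first by rewrite cut_diagram0.
  by rewrite -cat1s cut_diagram_cat -abacus_rE; apply: GM (Ggen (gp j)) IH.
have Gperm w : G (perm_diagram d w).
  elim/perm_adj_ind: w => [|i w IH]; first by rewrite perm_diagram1.
  by rewrite perm_diagramM -abacus_sE; apply: GM (Ggen (gs i)) IH.
have [w wa] := extends_exists a; change (G a);
  rewrite (abacus_decomposition wa).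
by apply: (GM) => //; apply: (GM) => //; apply: GM.
Qed.

Definition initial_segment j : seq 'I_n := [seq k : 'I_n <- enum 'I_n | k <= j].

Lemma mem_initial_segment j k : (k \in initial_segment j) = (k <= j).
Proof. by rewrite mem_filter mem_enum andbT. Qed.

Lemma cut_initial_segmentS i :
  cut_diagram d (initial_segment (hi i)) =
  cut_diagram d (initial_segment (lo i)) * abacus_r d (hi i).
Proof.
rewrite abacus_rE -cut_diagram_cat; apply: eq_cut_diagram => x.
by rewrite mem_cat inE !mem_initial_segment -val_eqE /=; lia.
Qed.

Lemma cut_initial_segment0 j : j = 0%N :> nat ->
  cut_diagram d (initial_segment j) = abacus_r d j.
Proof.
move=> j0; rewrite abacus_rE; apply: eq_cut_diagram => x.
by rewrite inE mem_initial_segment -val_eqE /= j0; lia.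
Qed.

Let s i := abacus_s d i.
Let o j := abacus_o d j.

Let ss i : s i * s i = 1.
Proof. by rewrite /s abacus_sE -perm_diagramM adjK perm_diagram1. Qed.

Let s_far i i' : (i.+1 < i') || (i'.+1 < i) -> s i * s i' = s i' * s i.
Proof. by move=> ii'; rewrite /s !abacus_sE -!perm_diagramM adj_far. Qed.

Let s_near i i' : (i.+1 == i') || (i'.+1 == i) ->
  s i * (s i' * s i) = s i' * (s i * s i').
Proof.
rewrite /s !abacus_sE -!perm_diagramM !mulgA.
by case/orP => /eqP/adj_near ->.
Qed.

Hypothesis d_gt0 : 0 < d.

Let od j : o j ^+ d = 1.
Proof.
rewrite /o abacus_oX -bead_diagram0; congr bead_diagram.
apply/ffunP => k; rewrite !ffunE; case: eqP => // _.
by apply: val_inj; rewrite /= prednK ?modnn.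
Qed.

Let oC j k : o j * o k = o k * o j.
Proof. by rewrite /o !abacus_oE -!bead_diagramD addrC. Qed.

Let os i j : o j * s i = s i * o (tperm (lo i) (hi i) j).
Proof.
rewrite /o /s !abacus_oE abacus_sE bead_permC; congr (_ * bead_diagram _).
apply/ffunP => k; rewrite !ffunE; congr (if _ then _ else _).
by rewrite -(inj_eq (@perm_inj _ (adj i))) permKV.
Qed.

Lemma abacus_gen_respects : respects (@abacus_gen n d) (@abacus_rel n d).
Proof.
move=> _ _ [i|i j|i j|i|i j|i j|i|i|i|i|i j|i j|i j|i k];
  rewrite !(evalw_cons, evalw0, evalw_cat, evalw_nseq, mulg1) /=.
- exact: ss.
- exact: s_far.
- exact: s_near.
- by rewrite abacus_rE -cut_diagram_cat; apply: eq_cut_diagram => x;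
    rewrite !inE orbb.
- rewrite !abacus_rE -!cut_diagram_cat; apply: eq_cut_diagram => x.
  by rewrite !inE orbC.
- move=> jl jh; rewrite abacus_rE abacus_sE cut_permC /=.
  by rewrite adjD.
- by rewrite !abacus_rE abacus_sE cut_permC /= adj_lo.
- by rewrite !abacus_rE abacus_sE cut_permC /= adj_hi.
(* Moved past the upper cut, the transposition stands above two cuts at the points that it
   exchanges, and is absorbed. *)
- rewrite !abacus_rE abacus_sE mulgA cut_permC /= adj_lo -mulgA.
  rewrite -!cut_diagram_cat perm_cut => [|x]; last first.
    by rewrite !inE negb_or => /andP[xh xl]; rewrite adjD.
  by apply: eq_cut_diagram => x; rewrite !inE orbC.
- exact: od.
- exact: oC.
- exact: os.
- move=> ij; rewrite abacus_rE abacus_oE bead_cutC // => x.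
  by rewrite !inE => /eqP ->; rewrite ffunE (negbTE ij).
- rewrite abacus_oX abacus_rE mulgA cut_bead_cutl // => x.
  by rewrite !inE ffunE => /negbTE ->.
Qed.

Definition framed_gen (x : gen n) : abacus n d :=
  match x with
  | gs i => abacus_s d i
  | gp j => cut_diagram d (initial_segment j)
  | gz j => abacus_o d j
  end.

Let zprod_bead j m : exists2 u, evalw framed_gen (zprod j m) = bead_diagram u &
  forall k, k \notin initial_segment j -> u k = 0%R.
Proof.
pose P b := exists2 u, b = bead_diagram u &
  forall k, k \notin initial_segment j -> u k = 0%R.
have P1 : P 1 by exists 0%R; rewrite ?bead_diagram0 // => k _; rewrite ffunE.
rewrite /zprod -/(initial_segment j).
(* The trivial inclusion separates the list of factors, over which the induction runs, from the
   fixed segment that bounds the support. *)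
have : {subset initial_segment j <= initial_segment j} by [].
elim: {1 3}(initial_segment j) => [|k A IH] sub; first by rewrite evalw0.
have [|v ev v0] := IH; first by move=> x xA; rewrite sub // inE xA orbT.
exists (single d k (m k) + v)%R => [|x xj].
  by rewrite /= evalw_cat evalw_nseq ev bead_diagramD abacus_oX.
rewrite !ffunE v0 // addr0; case: eqP => // xk.
by rewrite xk sub ?mem_head in xj.
Qed.

(** The transposition crosses the end of the segment only when [lo i] is its last point. *)
Let map_adj i j : i != j :> nat ->
  map (adj i) (initial_segment j) =i initial_segment j.
Proof.
move=> ij x; rewrite -{1}[x](tpermK (lo i) (hi i)) mem_map;
  last exact: perm_inj.
rewrite !mem_initial_segment.
have [->|xl] := eqVneq x (lo i); last have [->|xh] := eqVneq x (hi i).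
- by rewrite adj_lo /=; lia.
- by rewrite adj_hi /=; lia.
by rewrite adjD.
Qed.

Let perm_segment i j : i < j ->
  perm_diagram d (adj i) * cut_diagram d (initial_segment j) =
  cut_diagram d (initial_segment j).
Proof.
move=> ij; apply: perm_cut => x; rewrite mem_initial_segment -ltnNge => jx.
by rewrite adjD // -val_eqE /=; lia.
Qed.

Lemma framed_gen_respects : respects framed_gen (@framed_rel n d).
Proof.
move=> _ _ [i|i j|i j|i|i j|i j|i j|i j|i|i|i j|i j|i j|i j m|i j m];
  rewrite ?(evalw_cons, evalw0, evalw_cat, evalw_nseq, mulg1) /=.
- exact: ss.
- exact: s_far.
- exact: s_near.
- by rewrite -cut_diagram_cat; apply: eq_cut_diagram => x; rewrite mem_cat orbb.
- rewrite -!cut_diagram_cat; apply: eq_cut_diagram => x.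
  by rewrite !mem_cat orbC.
- move=> ij; rewrite abacus_sE cut_permC; congr (_ * _).
  by apply: eq_cut_diagram; apply: map_adj; lia.
- move=> ij; rewrite abacus_sE cut_permC.
  rewrite (eq_cut_diagram _ (map_adj _)) ?perm_segment //; lia.
- by move=> ij; rewrite abacus_sE perm_segment.
- rewrite abacus_sE mulgA cut_permC -mulgA -cut_diagram_cat.
  (* The transposition replaces the last point [lo i] of the segment by [hi i], so the two cuts
     together cover the segment up to [hi i]. *)
  have E : map (adj i) (initial_segment (lo i)) ++ initial_segment (lo i) =i
           initial_segment (hi i).
    move=> x; rewrite mem_cat -{1}[x](tpermK (lo i) (hi i)).
    rewrite mem_map; last exact: perm_inj.
    rewrite !mem_initial_segment.
    have [->|xl] := eqVneq x (lo i); last have [->|xh] := eqVneq x (hi i).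
    - by rewrite adj_lo /=; lia.
    - by rewrite adj_hi /=; lia.
    by rewrite adjD //; move: xl xh; rewrite -!val_eqE /=; lia.
  by rewrite (eq_cut_diagram _ E) perm_segment /=.
- exact: od.
- exact: oC.
- exact: os.
- move=> ij; rewrite abacus_oE bead_cutC // => x.
  rewrite mem_initial_segment ffunE; case: eqP => // ->; lia.
- move=> ij; have [u -> u0] := zprod_bead i m; rewrite mulgA cut_bead_cutl //.
  by move=> x; rewrite !mem_initial_segment => /leq_trans ->.
- move=> ij; have [u -> u0] := zprod_bead i m; rewrite mulgA cut_bead_cutr //.
  by move=> x; rewrite !mem_initial_segment => /leq_trans ->.
Qed.

End AbacusRelations.

(** * The framed rook monoid *)

Section PresentedMonoid.
Variables (X : choiceType) (R : seq X -> seq X -> Prop).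

Lemma evalw_pgen u : evalw (pgen R) u = pclass R u.
Proof.
elim: u => [|x u IH]; first by rewrite evalw0.
by rewrite evalw_cons IH; exact: pclass_cat.
Qed.

Lemma pgen_respects : respects (pgen R) R.
Proof. by move=> u v uv; rewrite !evalw_pgen; apply/pclassP/cc_rel. Qed.

Lemma presented_evalw (c : presented R) : c = evalw (pgen R) (repr c).
Proof. by rewrite evalw_pgen pclass_repr. Qed.

Variables (M : monoidType) (e : X -> M).
Hypothesis e_rel : respects e R.

Lemma presented_lift : exists f : presented R -> M,
  [/\ f 1 = 1, {morph f : a b / a * b} & forall x, f (pgen R x) = e x].
Proof.
have e_cc u v : congr_closure R u v -> evalw e u = evalw e v.
  elim=> {u v} [u v /e_rel|//|u v _ -> //|u v w _ -> _ -> //|u u' v v' _ eu _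
    ev].
    by [].
  by rewrite !evalw_cat eu ev.
have e_repr u : evalw e (repr (pclass R u)) = evalw e u.
  by apply: e_cc; apply/pclassP; rewrite pclass_repr.
exists (fun c => evalw e (repr c)); split=> [|a b|x].
- by rewrite [LHS]e_repr evalw0.
- by rewrite [LHS]e_repr evalw_cat.
- by rewrite [LHS]e_repr evalw1.
Qed.

End PresentedMonoid.

(** * Cuts of single strands in the framed rook monoid *)

Section FramedRook.
Variables (n d : nat) (M : monoidType) (e : gen n -> M).
Hypothesis n_gt0 : 0 < n.
Hypothesis e_rel : respects e (@framed_rel n d).
Implicit Types (i : 'I_n.-1) (j k : 'I_n) (w : 'S_n).

Let s i := e (gs i).
Let p j := e (gp j).
Let z j := e (gz j).
Let zero : 'I_n := Ordinal n_gt0.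

Let ss i : s i * s i = 1.
Proof. by have := e_rel (fr_ss d i); rewrite !evalw_cons evalw0 mulg1. Qed.

Let s_far i i' : (i.+1 < i') || (i'.+1 < i) -> s i * s i' = s i' * s i.
Proof. by move/fr_sC => /(_ d)/e_rel; rewrite !evalw_cons evalw0 !mulg1. Qed.

Let s_near i i' : i.+1 = i' -> s i * s i' * s i = s i' * s i * s i'.
Proof.
move=> ii'; have: (i.+1 == i') || (i'.+1 == i) by rewrite ii' eqxx.
by move/fr_sB => /(_ d)/e_rel; rewrite !evalw_cons evalw0 !mulg1 !mulgA.
Qed.

Let pp j : p j * p j = p j.
Proof. by have := e_rel (fr_pp d j); rewrite !evalw_cons evalw0 !mulg1. Qed.

Let ps j i : j < i -> p j * s i = s i * p j.
Proof. by move/fr_ps => /(_ d)/e_rel; rewrite !evalw_cons evalw0 !mulg1. Qed.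

Let psl j i : i < j -> p j * s i = p j.
Proof. by move/fr_ps_l => /(_ d)/e_rel; rewrite !evalw_cons evalw0 !mulg1. Qed.

Let psr j i : i < j -> s i * p j = p j.
Proof. by move/fr_ps_r => /(_ d)/e_rel; rewrite !evalw_cons evalw0 !mulg1. Qed.

Let psp i : p (lo i) * s i * p (lo i) = p (hi i).
Proof.
by have := e_rel (fr_psp d i); rewrite !evalw_cons evalw0 !mulg1 !mulgA.
Qed.

Let zs i j : z j * s i = s i * z (adj i j).
Proof. by have := e_rel (fr_zs d i j); rewrite !evalw_cons evalw0 !mulg1. Qed.

Let pz j k : j < k -> p j * z k = z k * p j.
Proof. by move/fr_pz => /(_ d)/e_rel; rewrite !evalw_cons evalw0 !mulg1. Qed.

(** At the first point [zprod] has a single factor; the corresponding relation at another point will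
    be a conjugate of this one. *)
Let pzp m : p zero * z zero ^+ m * p zero = p zero.
Proof.
have := e_rel (fr_pzp_l d (fun=> m) (leqnn zero)).
rewrite !evalw_cons evalw_cat evalw0 mulg1 evalw_cons evalw0 mulg1 mulgA.
rewrite /zprod.
have -> : [seq k : 'I_n <- enum 'I_n | k <= zero] = [:: zero].
  rewrite -(filter_pred1_uniq (enum_uniq 'I_n) (mem_enum 'I_n zero)).
  by apply: eq_filter => k; rewrite /= leqn0 -val_eqE.
by rewrite /= cats0 evalw_nseq.
Qed.

(* cut_elt k is the image of r_k, the conjugate of p_0 by the cycle
   s_(k-1) ... s_0. *)
Fixpoint cut_elt (k : nat) : M :=
  if k is k'.+1 then
    (if insub k' is Some i then e (gs i) * cut_elt k' * e (gs i) else 1)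
  else e (gp (Ordinal n_gt0)).

Let r j := cut_elt j.

Lemma cut_elt_hi i : cut_elt (hi i) = e (gs i) * cut_elt (lo i) * e (gs i).
Proof. by rewrite /= valK. Qed.

Let r_hi i : r (hi i) = s i * r (lo i) * s i.
Proof. exact: cut_elt_hi. Qed.

Let cut_eltS (k : nat) (kn : k < n.-1) :
  cut_elt k.+1 = s (Ordinal kn) * cut_elt k * s (Ordinal kn).
Proof. by rewrite /= insubT. Qed.

(** Induction on [m]. If i = m - 2, then [cut_elt m] is a double conjugate of [cut_elt i]; the braid
    relation turns [s i] into [s i'] inside, which commutes with [cut_elt i] by induction, and back.
    Otherwise [s i] commutes with every factor. *)
Let cut_elt_far (m : nat) i : m < n -> m != i -> m != i.+1 -> commute (cut_elt
  m) (s i).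
Proof.
have [N] := ubnP m; elim: N m i => // N IH [|k] i lt_km lt_kn ki ki1.
  by apply: (@ps zero); rewrite lt0n eq_sym.
have kn : k < n.-1 by lia.
pose i' : 'I_n.-1 := Ordinal kn.
rewrite (cut_eltS kn) -/i'.
have [near|nnear] := eqVneq i.+1 k; last first.
  have si : commute (s i) (s i') by apply: s_far; rewrite /=; lia.
  apply: commute_sym; apply: commuteM => //; apply: commuteM => //.
  by apply: commute_sym; apply: IH; lia.
have ii' : i.+1 = i' by [].
have -> : cut_elt k = s i * cut_elt i * s i.
  by rewrite -near (cut_eltS (ltn_ord i)); congr (s _ * _ * s _);
    apply: val_inj.
have ci' : commute (cut_elt i) (s i') by apply: IH; rewrite /=; lia.
rewrite /commute; have sn := s_near ii'.
transitivity (s i' * s i * cut_elt i * (s i * s i' * s i));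
  first by rewrite !mulgA.
rewrite sn.
transitivity (s i' * s i * (cut_elt i * s i') * s i * s i');
  first by rewrite !mulgA.
rewrite ci'.
transitivity (s i' * s i * s i' * cut_elt i * s i * s i');
  first by rewrite !mulgA.
by rewrite -sn !mulgA.
Qed.

Let rs i j : r j * s i = s i * r (adj i j).
Proof.
have [->|jl] := eqVneq j (lo i); last have [->|jh] := eqVneq j (hi i).
- by rewrite adj_lo r_hi !mulgA ss mul1g.
- by rewrite adj_hi r_hi -mulgA ss mulg1.
by rewrite adjD //; apply: cut_elt_far.
Qed.

Definition framed_rook_gen (x : gen n) : M :=
  match x with gs i => e (gs i) | gp j => cut_elt j | gz j => e (gz j) end.

(** Conjugation by permutations reduces the relations on cuts to the first one or two points, where
    they follow from the framed relations. *)
Lemma framed_rook_gen_respects : respects framed_rook_gen (@abacus_rel n d).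
Proof.
have [S [S1 SM Sadj]] := coxeter_morphism ss s_far s_near.
have SV w : S w * S w^-1 = 1 by rewrite -SM mulgV.
have VS w : S w^-1 * S w = 1 by rewrite -SM mulVg.
have rS w j : r (w j) = S w^-1 * r j * S w.
  elim/perm_adj_ind: w j => [|i w IH] j.
    by rewrite invg1 S1 perm1 mul1g mulg1.
  rewrite invgM !SM permM IH tpermV Sadj.
  have -> : r (adj i j) = s i * r j * s i by rewrite -mulgA rs mulgA ss mul1g.
  by rewrite !mulgA.
have zS w j : z (w j) = S w^-1 * z j * S w.
  elim/perm_adj_ind: w j => [|i w IH] j.
    by rewrite invg1 S1 perm1 mul1g mulg1.
  rewrite invgM !SM permM IH tpermV Sadj.
  have -> : z (adj i j) = s i * z j * s i by rewrite -mulgA zs mulgA ss mul1g.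
  by rewrite !mulgA.
have conjM w a b : (S w^-1 * a * S w) * (S w^-1 * b * S w) = S w^-1 * (a * b)
  * S w.
  by rewrite !mulgA -(mulgA _ (S w) (S w^-1)) SV mulg1.
have two_transitive j k : j != k ->
    exists i w, [/\ w (lo i) = j, w (hi i) = k & lo i = zero].
  move=> /perm_adjacent_pair[i [w [i0 wl wh]]].
  by exists i, w; split=> //; apply: val_inj.
have r0 : r zero = p zero by [].
(* In either order, [psp] gives [p (hi i)] with a factor [s i] on one side, which is absorbed. *)
have rr01 i : lo i = zero -> r zero * r (hi i) = p (hi i) /\
    r (hi i) * r zero = p (hi i).
  move=> i0; rewrite r_hi i0 r0 !mulgA -i0 psp psl //; split=> //.
  by rewrite -!mulgA [p _ * _]mulgA psp psr.
have transitive j : exists w, w zero = j.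
  by exists (tperm zero j); rewrite tpermL.
have rC j k : r j * r k = r k * r j.
  have [->//|njk] := eqVneq j k;
    have [i [w [<- <- i0]]] := two_transitive j k njk.
  rewrite !rS !conjM i0.
  by have [-> ->] := rr01 i i0.
have rr j : r j * r j = r j.
  by have [w <-] := transitive j; rewrite !rS conjM r0 pp.
change (respects (fun x : gen n => match x with
  gs i => s i | gp j => r j | gz j => z j end) (@abacus_rel n d)).
move=> _ _ [i|i j|i j|i|i j|i j|i|i|i|i|i j|i j|i j|i k];
  rewrite !(evalw_cons, evalw0, evalw_cat, evalw_nseq, mulg1) /=.
- exact: ss.
- exact: s_far.
- by rewrite !mulgA; case/orP => /eqP/s_near ->.
- exact: rr.
- exact: rC.
- by move=> jl jh; rewrite rs adjD.
- by rewrite rs adj_lo.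
- by rewrite rs adj_hi.
- have [i0 [w [wl wh i00]]] := two_transitive _ _ (lo_neq_hi i).
  have -> : s i = S w^-1 * s i0 * S w.
    by rewrite -!Sadj -!SM -mulgA -conjgE tpermJ wl wh.
  rewrite -wl -wh !rS !conjM i00; congr (_ * _ * _).
  by rewrite mulgA (rr01 i0 i00).1 r0 -i00 psp.
- by have := e_rel (fr_zd d i); rewrite evalw_nseq evalw0.
- by have := e_rel (fr_zC d i j); rewrite !evalw_cons evalw0 !mulg1.
- exact: zs.
- move=> ij; have [i0 [w [<- <- i00]]] := two_transitive i j ij.
  rewrite rS zS !conjM; congr (_ * _ * _); rewrite i00 r0.
  by apply: pz; rewrite -i00 /=.
- have [w <-] := transitive i; rewrite rS zS.
  have -> : (S w^-1 * z zero * S w) ^+ k = S w^-1 * z zero ^+ k * S w.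
    elim: k => [|k IH]; first by rewrite !expg0 mulg1 VS.
    by rewrite !expgS IH conjM.
  by rewrite !conjM r0 (mulgA (p zero)) pzp.
Qed.

(** If p_lo commutes with all cuts and absorbs r_lo, then p_hi = p_lo s p_lo = p_lo (r_lo s r_lo)
    p_lo = p_lo r_lo r_hi p_lo = p_lo r_hi. These two properties pass from p_lo to p_hi, so they
    hold by induction. *)
Lemma framed_p_hi i : e (gp (hi i)) = e (gp (lo i)) * cut_elt (hi i).
Proof.
rewrite -/(p _) -/(p _) -/(r _); have rrel := framed_rook_gen_respects.
have rC j k : commute (r j) (r k).
  by have := rrel _ _ (ar_rC d j k); rewrite !evalw_cons evalw0 !mulg1.
have rr j : r j * r j = r j.
  by have := rrel _ _ (ar_rr d j); rewrite !evalw_cons evalw0 !mulg1.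
have rsr i' : r (lo i') * s i' * r (lo i') = r (lo i') * r (hi i').
  by have := rrel _ _ (ar_rsr d i'); rewrite !evalw_cons evalw0 !mulg1 !mulgA.
have step i' : (forall j, commute (p (lo i')) (r j)) ->
    p (lo i') * r (lo i') = p (lo i') -> p (hi i') = p (lo i') * r (hi i').
  move=> pC pr; have rp : r (lo i') * p (lo i') = p (lo i') by rewrite -pC.
  transitivity (p (lo i') * (r (lo i') * s i' * r (lo i')) * p (lo i')).
    by rewrite !mulgA pr -[RHS]mulgA rp psp.
  by rewrite rsr mulgA pr -mulgA -(pC (hi i')) mulgA pp.
suff H (k : nat) (kn : k < n) : (forall j, commute (p (Ordinal kn)) (r j)) /\
    p (Ordinal kn) * cut_elt k = p (Ordinal kn).
  have [pC pr] := H _ (ltn_ord (lo i)).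
  have E : Ordinal (ltn_ord (lo i)) = lo i by apply: val_inj.
  by apply: step => [j|]; rewrite -E.
elim: k kn => [|k IH] kn.
  have -> : Ordinal kn = zero by apply: val_inj.
  split=> [j|]; last exact: pp.
  exact: (rC zero).
have kn1 : k < n.-1 by lia.
have kn' : k < n by lia.
pose i' : 'I_n.-1 := Ordinal kn1.
have -> : Ordinal kn = hi i' by apply: val_inj.
have El : lo i' = Ordinal kn' by apply: val_inj.
have [pC pr] := IH kn'; rewrite -El in pC pr.
have pE := step i' pC pr; split=> [j|].
  rewrite pE; apply: commute_sym; apply: commuteM; last exact: rC.
  exact/commute_sym/pC.
by rewrite pE -[RHS]pE -/(r (hi i')) -mulgA rr.
Qed.

End FramedRook.

Lemma ord_lo_hi_ind n (P : 'I_n -> Prop) :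
  (forall j : 'I_n, j = 0%N :> nat -> P j) -> (forall i, P (lo i) -> P (hi i))
    ->
  forall j, P j.
Proof.
move=> P0 PS [k kn]; elim: k kn => [|k IH] kn; first exact: P0.
have kn1 : k < n.-1 by lia.
have -> : Ordinal kn = hi (Ordinal kn1) by apply: val_inj.
by apply: PS; have := IH (ltnW kn); congr P; apply: val_inj.
Qed.

(** * The presentation of the abacus monoid and the isomorphism *)

Section Presentations.
Variables n d : nat.
Hypotheses (n_gt0 : 0 < n) (d_gt0 : 0 < d).

Lemma abacus_presentation : is_presentation (@abacus_rel n d) (@abacus_gen n d).
Proof.
have [f [f1 fM fgen]] := presented_lift (@abacus_gen_respects n d d_gt0).
have [g [g1 gM]] := abacus_evaluation d_gt0 (@pgen_respects _ (@abacus_rel n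
  d)).
have fE := morphism_evalw f1 (fun x a => etrans (fM _ a) (congr1 (mul^~ _)
  (fgen x))).
have gE := morphism_evalw g1 gM.
(* On either side every element is the value of a word, and [f] and [g] preserve the word. *)
exists f; split=> //; exists g => [c|a].
  by rewrite [c]presented_evalw fE gE.
by have [u ->] := abacus_generated a; rewrite gE fE.
Qed.

Lemma framed_rook_isomorphic : monoid_isomorphic (framed_rook n d) (abacus n d).
Proof.
have p_rel := @pgen_respects _ (@framed_rel n d).
have a_rel := @abacus_gen_respects n d d_gt0.
have r_rel := framed_rook_gen_respects n_gt0 p_rel.
have [f [f1 fM fgen]] := presented_lift (@framed_gen_respects n d d_gt0).
have [g [g1 gM]] := abacus_evaluation d_gt0 r_rel.
exists f; split=> //.
(* [g] is built from the single cuts; it respects the cuts of initial segments by induction, as in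
   both monoids each of these is the previous one times a single cut. *)
have gF x a : g (framed_gen d x * a) = pgen (@framed_rel n d) x * g a.
  case: x => [i|j|j]; [exact: (gM (gs i))| |exact: (gM (gz j))].
  elim/ord_lo_hi_ind: j a => [j j0|i IH] a; rewrite [framed_gen _ _]/=.
    rewrite cut_initial_segment0 // (gM (gp j)) [framed_rook_gen _ _ _]/= j0.
    by congr (pgen _ (gp _) * _); apply: val_inj.
  rewrite cut_initial_segmentS -mulgA IH (gM (gp (hi i))) mulgA.
  by rewrite (framed_p_hi n_gt0 p_rel).
have fE := morphism_evalw f1 (fun x a => etrans (fM _ a) (congr1 (mul^~ _)
  (fgen x))).
have gE := morphism_evalw g1 gF.
have fr (j : 'I_n) : f (cut_elt (pgen (@framed_rel n d)) n_gt0 j) = abacus_r d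
  j.
  elim/ord_lo_hi_ind: j => [j j0|i IH].
    rewrite j0 /= fgen -(cut_initial_segment0 d j0).
    by congr (cut_diagram _ (initial_segment _)); apply: val_inj.
  rewrite cut_elt_hi !fM IH !fgen /= -mulgA.
  have := a_rel _ _ (ar_rslo d i); have := a_rel _ _ (ar_ss d i).
  rewrite !evalw_cons !evalw0 !mulg1 /= => ss ->.
  by rewrite mulgA ss mul1g.
(* The composite respects left multiplication by the abacus generators, so it fixes every word in
   them. *)
have fG a x : f (g (abacus_gen d x * a)) = abacus_gen d x * f (g a).
  by rewrite gM fM; congr (_ * _); case: x => /= [i|j|j]; rewrite ?fgen ?fr.
exists g => [c|a].
  by rewrite [c]presented_evalw fE gE.
have [u ->] := abacus_generated a.
have fg1 : (f \o g) 1 = 1 by rewrite /= g1.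
by rewrite -[LHS]/((f \o g) _) (morphism_evalw fg1 (fun x a => fG a x)).
Qed.

End Presentations.

Local Close Scope group_scope.

(** * Counting *)

Section PartialInjections.
Variable n : nat.
Implicit Types (f : {ffun 'I_n -> option 'I_n}) (A : {set 'I_n}).

Definition domain f : {set 'I_n} := [set j | f j != None].

Definition partial_injective f :=
  [forall j, forall k, (f j != None) && (f j == f k) ==> (j == k)].

Lemma partial_injectiveP f :
  reflect (forall j k x, f j = Some x -> f k = Some x -> j = k)
          (partial_injective f).
Proof.
apply: (iffP forallP) => [fP j k x fj fk|fP j].
  by have /forallP/(_ k) := fP j; rewrite fj fk eqxx => /eqP.
apply/forallP => k; apply/implyP => /andP[]; case fj: (f j) => [x|] // _.
by rewrite eq_sym => /eqP/(fP _ _ _ fj) ->.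
Qed.

(** Extension by [None] outside [A] identifies the injections from [A] to ['I_n] with these partial
    injections. *)
Lemma card_partial_injective A :
  #|[pred f | partial_injective f & domain f == A]| = n ^_ #|A|.
Proof.
pose F (g : {ffun {j | j \in A} -> 'I_n}) : {ffun 'I_n -> option 'I_n} :=
  [ffun j => omap g (insub j)].
have FA g j (jA : j \in A) : F g j = Some (g (Sub j jA)).
  by rewrite ffunE insubT.
have FnA g j : j \notin A -> F g j = None by move=> jA; rewrite ffunE insubN.
have F_inj : injective F.
  move=> g h gh; apply/ffunP => -[j jA].
  by have := congr1 (fun f : {ffun _ -> _} => f j) gh; rewrite !FA => -[].
have -> : n ^_ #|A| =
    #|[set g : {ffun {j | j \in A} -> 'I_n} | injectiveb g]|.
  by rewrite card_inj_ffuns card_ord card_sig; congr (_ ^_ _); apply: eq_card.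
rewrite -(fintype.card_image F_inj); apply: eq_card => f; rewrite inE.
apply/andP/fintype.imageP => [[/partial_injectiveP fP /eqP domf]|[g]].
  have fA j : (j \in A) = (f j != None) by rewrite -domf inE.
  exists [ffun j : {j | j \in A} => odflt (val j) (f (val j))].
    rewrite inE; apply/injectiveP => -[j jA] [k kA]; rewrite !ffunE /= => jk.
    apply: val_inj => /=; rewrite !fA in jA kA.
    case fj: (f j) jA jk => [x|] // _; case fk: (f k) kA => [y|] // _ /= xy.
    by apply: (fP _ _ x) => //; rewrite fk xy.
  apply/ffunP => j; have [jA|jA] := boolP (j \in A).
    by rewrite FA ffunE /=; move: jA; rewrite fA; case: (f j).
  by rewrite FnA //; move: jA; rewrite fA negbK => /eqP.
rewrite inE => /injectiveP g_inj ->; split.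
  apply/partial_injectiveP => j k x.
  have [jA|jA] := boolP (j \in A); last by rewrite FnA.
  have [kA|kA] := boolP (k \in A); last by rewrite (FnA _ k).
  by rewrite !FA => -[<-] [] /g_inj [].
apply/eqP/setP => j; rewrite inE.
by have [jA|jA] := boolP (j \in A); rewrite ?(FA _ _ jA) ?FnA.
Qed.

End PartialInjections.

(** * The number of abaci *)

Section AbacusCardinality.
Variables n d : nat.
Hypothesis d_gt0 : 0 < d.
Implicit Types (f : {ffun 'I_n -> option 'I_n}) (A : {set 'I_n}).

Lemma dn_partial_injective (a : abacus n d) : partial_injective (dn a).
Proof. by apply/partial_injectiveP => j k x /dn_up jx /dn_up;
  rewrite jx => -[]. Qed.

(** The beads at the n top points are free, and so are those at the bottom points missed by [f]; at
    the other bottom points the lines determine them. *)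
Lemma card_abacus_dn f : partial_injective f ->
  #|[pred a : abacus n d | dn a == f]| = d ^ n * d ^ (n - #|domain f|).
Proof.
move=> /partial_injectiveP fP.
pose missed := [pred k | [forall j, f j != Some k]].
have card_missed : #|missed| = n - #|domain f|.
  have cn : #|missed| + #|[predC missed]| = n by rewrite cardC card_ord.
  rewrite -[X in X - _]cn addnC.
  suff -> : #|[predC missed]| = #|domain f| by rewrite addKn.
  pose g j := odflt j (f j).
  rewrite -(@fintype.card_in_image _ _ g (domain f)) => [|j k]; last first.
    rewrite !inE /g; case fj: (f j) => [x|] // _;
      case fk: (f k) => [y|] // _ /= xy.
    by apply: (fP _ _ x) => //; rewrite fk xy.
  apply: eq_card => k; rewrite !inE negb_forall.
  apply/existsP/fintype.imageP => [[j]|[j]].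
    by rewrite negbK => /eqP fj; exists j; rewrite ?inE /g fj.
  by rewrite inE /g; case fj: (f j) => [x|] // _ ->; exists j;
    rewrite fj negbK /=.
(* [h] keeps the independent data: the top beads, and the bottom beads set to zero off the broken
   arcs. *)
pose h (a : abacus n d) :=
  (topb a, [ffun k => if up a k is None then botb a k else 0%R]).
have card_beads : #|{: beads d}| = d by rewrite card_ord prednK.
have cardQ : #|[predX {: {ffun 'I_n -> beads d}} &
               pffun_on (0%R : beads d) missed predT]| = d ^ n * d ^ (n -
                 #|domain f|).
  by rewrite cardX card_ffun card_pffun_on card_missed card_beads card_ord.
rewrite -cardQ -(@fintype.card_in_image _ _ h) => [|a b]; last first.
  rewrite !inE => /eqP af /eqP bf [] tab /ffunP bab.
  have dab : dn a = dn b by rewrite af.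
  have uab k : up a k = up b k.
    case E: (up a k) => [j|].
      by apply/esym/dn_up; rewrite -dab; apply/dn_up.
    case F: (up b k) => [j|] //.
    by move: F => /dn_up; rewrite -dab => /dn_up; rewrite E.
  apply: abacus_eq => k; rewrite ?dab ?uab ?tab //.
  case E: (up b k) => [j|]; last by have := bab k; rewrite !ffunE uab E.
  have /dn_up Eb := E; have Ea := Eb; rewrite -dab in Ea.
  by rewrite -(topb_botb Ea) -(topb_botb Eb) tab.
apply: eq_card => -[t v]; rewrite !inE /=.
apply/fintype.imageP/pffun_onP => [[a]|[v0 _]].
  rewrite inE => /eqP af [_ ->]; split=> [|x]; last by [].
  apply/fintype.subsetP => k; rewrite !inE ffunE.
  case E: (up a k) => [j|]; first by rewrite eqxx.
  move=> _; apply/forallP => j; apply/eqP; rewrite -af => /dn_up.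
  by rewrite E.
(* For surjectivity, the upward map inverts [f] and the bottom beads are copied from the top along
   lines. *)
pose upf : {ffun 'I_n -> option 'I_n} := [ffun k => [pick j | f j == Some k]].
have upfP j k : f j = Some k <-> upf k = Some j.
  rewrite ffunE; case: pickP => [i /eqP fi|nf].
    by split=> [fj|[<-] //]; congr Some; apply: fP fi fj.
  by split=> // fj; have := nf j; rewrite fj eqxx.
pose bot : {ffun 'I_n -> beads d} :=
  [ffun k => if upf k is Some j then t j else v k].
have ax : abacus_axiom (f, upf, t, bot).
  apply: abacus_axiomP => // j k fj.
  by rewrite ffunE; have /upfP -> := fj.
exists (Abacus ax); first by rewrite inE.
congr (_, _); apply/ffunP => k; rewrite ffunE /up /botb /=.
rewrite [bot k]ffunE; case E: (upf k) => [j|] //.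
apply/eqP; apply: contraT => vk.
have /forallP/(_ j) : k \in missed by apply: (fintype.subsetP v0); rewrite inE.
by have /upfP -> := E; rewrite eqxx.
Qed.

(** Diagrams are grouped by their lines, then by domain, then by its size k: there are C(n,k)
    domains, C(n,k) k! injections on each, and d^(2n-k) distributions of beads. *)
Lemma card_abacus :
  #|{: abacus n d}| = \sum_(k < n.+1) 'C(n, k) ^ 2 * k`! * d ^ (2 * n - k).
Proof.
have fiberwise (T I : finType) (P : pred T) (Q : pred I) (p : T -> I) (F : I
  -> nat) :
    (forall x, P x -> Q (p x)) ->
    \sum_(x | P x) F (p x) = \sum_(i | Q i) #|[pred x | P x & p x == i]| * F i.
  move=> PQ; rewrite (partition_big p Q PQ); apply: eq_bigr => i _.
  rewrite -sum1_card big_distrl /=; apply: eq_bigr => x /andP[_ /eqP ->].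
  by rewrite mul1n.
transitivity (\sum_(a : abacus n d) 1); first by rewrite sum1_card.
rewrite (@fiberwise _ _ predT (@partial_injective n) (@dn n d) (fun=> 1)) =>
  [|a _];
  last exact: dn_partial_injective.
rewrite (eq_bigr (fun f => d ^ (2 * n - #|domain f|))) => [|f fP]; last first.
  rewrite muln1 card_abacus_dn // -expnD; congr (_ ^ _).
  have le_n : #|domain f| <= n by rewrite -[leqRHS]card_ord max_card.
  by rewrite addnBA // addnn mul2n.
rewrite (@fiberwise _ _ (@partial_injective n) predT (@domain n)
  (fun A => d ^ (2 * n - #|A|))) //.
rewrite (eq_bigr (fun A : {set 'I_n} => n ^_ #|A| * d ^ (2 * n - #|A|))) =>
  [|A _];
  last by rewrite card_partial_injective.
have card_lt (A : {set 'I_n}) : #|A| < n.+1.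
  by rewrite ltnS -[leqRHS]card_ord max_card.
rewrite (@fiberwise _ _ predT predT (fun A : {set 'I_n} => Ordinal (card_lt A))
  (fun k => n ^_ k * d ^ (2 * n - k))) //.
apply: eq_bigr => k _; rewrite mulnA; congr (_ * _).
rewrite -bin_ffact mulnA -mulnn; congr (_ * _ * _).
have -> : 'C(n, k) = #|[set A : {set 'I_n} | #|A| == k]|.
  by rewrite card_draws card_ord.
by apply: eq_card => A; rewrite !inE -val_eqE.
Qed.

End AbacusCardinality.

Local Open Scope classical_set_scope.
Local Open Scope card_scope.
Local Open Scope nat_scope.

Theorem theorem3p4 (n d : nat) (n_gt0 : 0 < n) (d_gt0 : 0 < d) :
  [/\ is_presentation (@abacus_rel n d) (@abacus_gen n d),
      monoid_isomorphic (framed_rook n d) (abacus n d) &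
      [set: framed_rook n d] #=
        `I_(\sum_(k < n.+1) 'C(n, k) ^ 2 * k`! * d ^ (2 * n - k))].
Proof.
have iso := framed_rook_isomorphic n_gt0 d_gt0.
split; [exact: abacus_presentation | exact: iso |].
have [f [_ _ [g fK gK]]] := iso.
rewrite -(card_abacus n d_gt0).
(* The isomorphism followed by the enumeration of the finite type of abaci numbers the classes of
   words. *)
apply/card_set_bijP; exists (fun c => nat_of_ord (enum_rank (f c))).
split=> [c _|b c _ _|m /= lt_m]; first exact: ltn_ord.
  by move/val_inj/enum_rank_inj/(can_inj fK).
exists (g (enum_val (Ordinal lt_m))) => //.
by rewrite gK enum_valK.
Qed.
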